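(* **I.** There exists a universal constant $A>0$ such that for any probability measure $\mu$ on $\mathbb{R}$ with finite moments, any bounded function $f:\mathbb{R}\to\mathbb{R}$, any $\varepsilon>0$, and any $n\in \mathbb{N}$, $$P\left( \left|\frac{1}{n} X_f^{(n)}-\frac{1}{n}\mathbb{E} X_f^{(n)} \right|\geq \varepsilon \right)\leq 2 \exp \left(- n \varepsilon \min\left( \frac{ \varepsilon}{8A \|f\|_\infty^2}, \frac{1}{6 \|f \|_\infty} \right) \right).$$ In particular, if $\mu_n$ is a sequence of such measures for which $\frac{K_n(x,x)}{n}d\mu_n(x)$ (with $K_n$ the $n$-th Christoffel-Darboux kernel of $\mu_n$) has a weak limit $\nu$, and $f$ is bounded and continuous, then $$\lim_{n\to \infty} \frac{1}{n} X_f^{(n)}= \int f(x) \, d\nu(x)$$ almost surely. **II.** Assume that either $\mu$ has compact support and $f$ is continuous; or that the sequence $\{\mu_n\}_{n=1}^\infty$ satisfies $\frac{1}{n}\left(\frac{\gamma_{n-1}^{(n)}}{\gamma_n^{(n)}}\right)^2 \rightarrow 0$ as $n \rightarrow \infty$, and $f$ is uniformly continuous and bounded. Then for any $\varepsilon>0$ $$P\left( \left|\frac{1}{n} X_f^{(n)}-\frac{1}{n}\mathbb{E} X_f^{(n)} \right|\geq \varepsilon \right)\leq 2 \exp \left(- \frac{n\varepsilon }{6 \|f \|_\infty} \right)$$ for $n \in \mathbb{N}$ sufficiently large. **III.** Suppose that $\mu$ has compact support, or $\mu=\mu_n$ with $\left(\frac{\gamma_{n-1}^{(n)}}{\gamma_n^{(n)}}\right)^2=\mathcal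 O (1)$ as $n \rightarrow \infty$. Then there exists a constant $A$ such that for any Lipschitz function $f$ with Lipschitz constant $|f|_{\mathcal L}$, and any $\varepsilon>0$, $$P\left( \left| X_f^{(n)}- \mathbb{E} X_f^{(n)} \right|\geq \varepsilon \right)\leq 2 \exp \left(- \varepsilon \min\left( \frac{ \varepsilon}{ 4A |f|_{\mathcal L}^2}, \frac{1}{6 \|f \|_\infty} \right) \right)$$ for $n \in \mathbb{N}$ sufficiently large.
   Context: All measures are probability measures on $\mathbb{R}$ with finite moments and infinite support; functions $f:\mathbb{R}\to\mathbb{R}$ are Borel. For such $\mu$, $p_j(x)=\gamma_jx^j+\dots$, $\gamma_j>0$, are the orthonormal polynomials and $K_n(x,y)=\sum_{j=0}^{n-1}p_j(x)p_j(y)$ is the Christoffel-Darboux kernel; for a sequence $\mu_n$, $\gamma_j^{(n)}$ is the leading coefficient of the $j$-th orthonormal polynomial of $\mu_n$. The orthogonal polynomial ensemble (OPE) of size $n$ associated with $\mu$ is the probability measure $\frac{1}{Z_n}\prod_{i>j}(\lambda_i-\lambda_j)^2\,d\mu(\lambda_1)\cdots d\mu(\lambda_n)$ on $\mathbb{R}^n$, with $Z_n$ a normalizing constant. $X_f^{(n)}=\sum_{j=1}^n f(\lambda_j)$ with $(\lambda_1,\dots,\lambda_n)$ random from the OPE of size $n$ associated with $\mu$ (respectively with $\mu_n$, when a sequence of measures is considered); $P$, $\mathbb{E}$ refer to it. For the almost sure statement the random points for different $n$ are realized on a common probability space (arbitrary coupling). $\|f\|_\infty$ is the supremum norm of $f$,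 with the conventions $1/0=+\infty$ and $1/\infty=0$. *)

(* Defs.v *)
From HB Require Import structures.
From mathcomp Require Import all_boot all_order all_algebra.
From mathcomp Require Import all_classical all_reals all_analysis.
From mathcomp Require Import measurable_realfun.

Set Implicit Arguments.
Unset Strict Implicit.
Unset Printing Implicit Defensive.

Import Order.TTheory GRing.Theory Num.Theory.
Import numFieldNormedType.Exports.

Local Open Scope classical_set_scope.
Local Open Scope ring_scope.

Section density.
Context d (T : measurableType d) (R : realType).
Variables (mu : {measure set T -> \bar R}) (w : T -> R).
Hypotheses (mw : measurable_fun setT w) (w0 : forall x, 0 <= w x).

(* The measure w dmu; mw and w0 are arguments only so that the measure
   structure below can be inferred. *)
Definition density (_ : measurable_fun setT w) (_ : forall x, 0 <= w x)
  (A : set T) : \bar R := (\int[mu]_(x in A) (w x)%:E)%E.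

Local Notation nu := (density mw w0).

Let nu0 : nu set0 = 0%E.
Proof. by rewrite /density integral_set0. Qed.

Let nu_ge0 A : (0 <= nu A)%E.
Proof. by apply: integral_ge0 => x _; rewrite lee_fin. Qed.

Let nu_sigma_additive : semi_sigma_additive nu.
Proof.
move=> F mF tF mUF; rewrite /density ge0_integral_bigcup//=.
- by apply: is_cvg_ereal_nneg_natsum_cond => n _ _; exact: nu_ge0.
- by apply/measurable_EFinP; exact: measurable_funS mw.
- by move=> x _; rewrite lee_fin.
Qed.

HB.instance Definition _ :=
  isMeasure.Build d T R nu nu0 nu_ge0 nu_sigma_additive.

End density.

Section power_measure.
Context d (T : measurableType d) (R : realType).

Definition tuple_cons n (x : T * n.-tuple T) : n.+1.-tuple T :=
  [the n.+1.-tuple T of x.1 :: x.2].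

Lemma measurable_tuple_cons n : measurable_fun setT (@tuple_cons n).
Proof. exact: measurable_cons. Qed.

HB.instance Definition _ n :=
  isMeasurableFun.Build _ _ _ _ (@tuple_cons n) (@measurable_tuple_cons n).

Fixpoint power_measure (mu : probability T R) n : probability (n.-tuple T) R :=
  match n with
  | 0 => \d_([tuple] : 0.-tuple T)
  | m.+1 => distribution (mu \x power_measure mu m)%E (@tuple_cons m)
  end.

End power_measure.

Section orthogonal_polynomials.
Context (R : realType).
Implicit Types mu : probability R R.

Definition finite_moments mu :=
  forall k : nat, mu.-integrable setT (fun x => (x ^+ k)%:E).

Definition msupport mu : set R :=
  [set x | forall U : set R, open U -> U x -> (0 < mu U)%E].

Definition admissible mu := finite_moments mu /\ infinite_set (msupport mu).

Definition orthonormal_polys mu (p : nat -> {poly R}) :=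
  (forall j, size (p j) = j.+1 /\ 0 < lead_coef (p j)) /\
  (forall i j, \int[mu]_x ((p i).[x] * (p j).[x])%:E = ((i == j)%:R : R)%:E)%E.

(* When mu is admissible, exactly one sequence satisfies orthonormal_polys mu,
   and orthopoly mu is that sequence. *)
Definition orthopoly mu : nat -> {poly R} :=
  xget (fun=> 0) (orthonormal_polys mu).

Definition gamma mu (j : nat) : R := lead_coef (orthopoly mu j).

Definition CD_kernel mu (n : nat) (x y : R) : R :=
  \sum_(j < n) (orthopoly mu j).[x] * (orthopoly mu j).[y].

Definition CD_weight mu (n : nat) (x : R) : R := CD_kernel mu n x x / n%:R.

Lemma measurable_CD_weight mu n : measurable_fun setT (CD_weight mu n).
Proof.
apply: measurable_funM => //; apply: measurable_sum => j.
by apply: measurable_funM; apply: continuous_measurable_fun;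
  exact: continuous_horner.
Qed.

Lemma CD_weight_ge0 mu n x : 0 <= CD_weight mu n x.
Proof.
by rewrite divr_ge0// sumr_ge0// => j _; rewrite -expr2 sqr_ge0.
Qed.

Definition CD_measure mu (n : nat) : {measure set R -> \bar R} :=
  density mu (@measurable_CD_weight mu n) (@CD_weight_ge0 mu n).

Definition weak_limit (m : nat -> {measure set R -> \bar R})
    (nu : {measure set R -> \bar R}) :=
  forall g : R -> R, continuous g -> bounded_fun g ->
    (\int[m n]_x (g x)%:E)%E @[n --> \oo] --> (\int[nu]_x (g x)%:E)%E.

End orthogonal_polynomials.

Section orthogonal_polynomial_ensemble.
Context (R : realType).
Implicit Types mu : probability R R.

Definition vandermonde_sq n (l : n.-tuple R) : R :=
  \prod_(i < n) \prod_(j < n | (j < i)%N) (tnth l i - tnth l j) ^+ 2.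

Lemma measurable_vandermonde_sq n : measurable_fun setT (@vandermonde_sq n).
Proof.
apply: measurable_prod => i _; under eq_fun do rewrite -big_filter.
apply: measurable_prod => j _; apply: measurable_funX.
by apply: measurable_funB; exact: measurable_tnth.
Qed.

Lemma vandermonde_sq_ge0 n (l : n.-tuple R) : 0 <= vandermonde_sq l.
Proof. by apply: prodr_ge0 => i _; apply: prodr_ge0 => j _; exact: sqr_ge0. Qed.

(* The last argument of mnormalize is a default value, used only if the
   normalizing constant Z_n is 0 or +oo; this never happens when mu is
   admissible. *)
Definition OPE mu n : probability (n.-tuple R) R :=
  mnormalize (density (power_measure mu n) (@measurable_vandermonde_sq n)
                      (@vandermonde_sq_ge0 n))
             (power_measure mu n).

Definition linstat (f : R -> R) n (l : n.-tuple R) : R :=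
  \sum_(i < n) f (tnth l i).

(* Only used where linstat f is integrable, so that fine loses nothing. *)
Definition mean_linstat mu n (f : R -> R) : R :=
  fine ('E_(OPE mu n)[linstat f (n := n)])%E.

End orthogonal_polynomial_ensemble.

Section function_norms.
Context (R : realType).

(* Both norms are extended reals, so that the inverse of constructive_ereal,
   for which 0^-1 = +oo and +oo^-1 = 0, can be applied to them. *)
Definition supnorm (f : R -> R) : \bar R :=
  ereal_sup [set (`|f x|)%:E | x in [set: R]].

Definition lipnorm (f : R -> R) : \bar R :=
  ereal_sup [set (`|f z.1 - f z.2| / `|z.1 - z.2|)%:E
            | z in [set z : R * R | z.1 != z.2]].

End function_norms.

(* Main.v *)
Require Import Defs.
From mathcomp Require Import all_boot all_order all_algebra.
From mathcomp Require Import perm spectral ring lra.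
From mathcomp.real_closed Require Import complex.
From mathcomp Require Import all_classical all_reals all_analysis.
From mathcomp Require Import measurable_realfun.

(** Let X be the linear statistic of f, and for a bounded function h let G(h) be
    the n x n matrix of the integrals of h p_j p_k, with j, k < n.  Andreief's
    identity gives E exp(tX) = det G(exp(tf)) and E X = tr G(f).  Let U be a
    unitary matrix diagonalizing G(f), with eigenvalues d_i, and let D be the
    diagonal matrix of the exp(- t d_i / 2).  Since det H <= exp(tr H - n) for a
    positive semidefinite H, taking H = D U G(exp(tf)) U* D bounds
    E exp(t(X - E X)) by the exponential of the sum over i of the integrals of
    exp(t(f - d_i)) - 1 against probability measures w_i dmu with
    int (f - d_i) w_i dmu = 0.  As exp(s) <= 1 + s + 3 s^2 for |s| <= 2/3, this
    is at most exp(3 t^2 V), where V = tr G(f^2) - tr G(f)^2 is the variance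
    of X, and Chernoff's bound follows.  Finally 2 V is the double integral of
    (f(x) - f(y))^2 K_n(x,y)^2, so V is at most n sup|f|^2; and since V is
    (gamma_{n-1} / gamma_n)^2 when f(x) = x, comparing f with the identity makes
    V bounded for Lipschitz f and o(n) for uniformly continuous f. *)

Set Implicit Arguments.
Unset Strict Implicit.
Unset Printing Implicit Defensive.

Import Order.TTheory GRing.Theory Num.Theory.
Import numFieldNormedType.Exports.

Local Open Scope classical_set_scope.
Local Open Scope ring_scope.

(** * Real-valued integrals *)

(** The bound det H <= exp(tr H - n) is sharp only near the identity, and a scalar normalization of
    G(exp(tf)) would not come close to it, because the eigenvalues of G(f) are in general spread
    over the range of f. Conjugation by D U centres each direction at its own d_i: the term of first
    order in t cancels in every diagonal entry, a variance remains, and det D^2 = exp(- t tr G(f))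
    is exactly the centring factor exp(- t E X). Since |d_i| <= sup|f|, the condition |s| <= 2/3
    becomes |t| sup|f| <= 1/3. Under it, t = min(eps / (6 V), 1 / (3 sup|f|)) leaves the exponent -
    t eps / 2, which is the source of the constant 6 in front of sup|f| and of the constants A. The
    eigenvectors are complex, so each weight w_i is a sum of two squares. The comparison function
    f(x) = x is unbounded, so the variance identities are proved under integrability instead of
    boundedness. *)

Notation Rintegrable mu f := (mu.-integrable setT (fun x => (f x)%:E)).

Section real_integrals.
Context d (T : measurableType d) (R : realType) (mu : {measure set T -> \bar R}).
Implicit Types f g : T -> R.

Lemma Rintegrable_measurable f : Rintegrable mu f -> measurable_fun setT f.
Proof. by move=> /measurable_int /measurable_EFinP. Qed.

Lemma RintegrableD f g : Rintegrable mu f -> Rintegrable mu g ->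
  Rintegrable mu (fun x => f x + g x).
Proof. by move=> intf intg; exact: (integrableD _ intf intg). Qed.

Lemma RintegrableZl r f : Rintegrable mu f -> Rintegrable mu (fun x => r * f x).
Proof. by move=> intf; exact: (integrableZl _ r intf). Qed.

Lemma Rintegrable_sum I (s : seq I) (P : pred I) (f : I -> T -> R) :
  (forall i, P i -> Rintegrable mu (f i)) ->
  Rintegrable mu (fun x => \sum_(i <- s | P i) f i x).
Proof.
move=> intf; under eq_fun do rewrite -sumEFin.
by apply: integrable_sum => // i Pi; exact: intf.
Qed.

Lemma Rintegral_sum I (s : seq I) (P : pred I) (f : I -> T -> R) :
  (forall i, P i -> Rintegrable mu (f i)) ->
  \int[mu]_x (\sum_(i <- s | P i) f i x) = \sum_(i <- s | P i) \int[mu]_x f i x.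
Proof.
move=> intf; elim: s => [|i s IH].
  under eq_Rintegral do rewrite big_nil.
  by rewrite Rintegral_cst// mul0r big_nil.
under eq_Rintegral do rewrite big_cons.
rewrite big_cons; case: ifPn => Pi; last exact: IH.
by rewrite RintegralD ?IH//; [exact: intf|exact: Rintegrable_sum].
Qed.

Lemma Rintegral_EFin f : Rintegrable mu f ->
  (\int[mu]_x (f x)%:E)%E = (\int[mu]_x f x)%:E.
Proof. by move=> intf; rewrite fineK//; exact: integrable_fin_num. Qed.

Lemma le_Rintegrable f g : measurable_fun setT f -> Rintegrable mu g ->
  (forall x, `|f x| <= `|g x|) -> Rintegrable mu f.
Proof.
move=> mf intg fg; apply: le_integrable intg => //.
  exact/measurable_EFinP.
by move=> x _; rewrite lee_fin fg.
Qed.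

Lemma RintegrableMl B f g : measurable_fun setT f -> (forall x, `|f x| <= B) ->
  Rintegrable mu g -> Rintegrable mu (fun x => f x * g x).
Proof.
move=> mf fB intg; apply: (@le_Rintegrable _ (fun x => B * g x)).
- by apply: measurable_funM => //; exact: Rintegrable_measurable intg.
- exact: RintegrableZl.
- move=> x; rewrite !normrM ler_wpM2r//.
  by rewrite (le_trans (fB x))// ler_norm.
Qed.

End real_integrals.

(** * Integration against a measure with a density *)

Section integral_density.
Context d (T : measurableType d) (R : realType).
Variables (mu : {measure set T -> \bar R}) (w : T -> R).
Hypotheses (mw : measurable_fun setT w) (w0 : forall x, 0 <= w x).

Local Open Scope ereal_scope.
Import HBNNSimple.

Lemma ge0_integral_density (f : T -> R) : measurable_fun setT f ->
  (forall x, 0 <= f x)%R ->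
  \int[density mu mw w0]_x (f x)%:E = \int[mu]_x (f x * w x)%:E.
Proof.
move=> mf f0.
have mfE : measurable_fun setT (EFin \o f) by exact/measurable_EFinP.
pose h := nnsfun_approx measurableT mfE.
have hE x : (f x)%:E = limn (EFin \o h ^~ x).
  by apply/esym/cvg_lim => //; apply: cvg_nnsfun_approx => // y _; rewrite lee_fin.
transitivity (limn (fun n => \int[density mu mw w0]_x (h n x)%:E)).
  under eq_integral do rewrite hE.
  apply: monotone_convergence => //=.
  - by move=> n; exact/measurable_EFinP.
  - by move=> n x _; rewrite lee_fin.
  - by move=> x _ a b ab; rewrite lee_fin; exact/lefP/nd_nnsfun_approx.
transitivity (limn (fun n => \int[mu]_x (h n x * w x)%:E)); last first.
  rewrite -monotone_convergence//=.
  - apply: eq_integral => x _; apply/cvg_lim => //.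
    rewrite EFinM; under eq_fun do rewrite EFinM.
    apply: cvgeZr => //; rewrite hE.
    apply: ereal_nondecreasing_is_cvgn => a b ab /=.
    by rewrite lee_fin; exact/lefP/nd_nnsfun_approx.
  - by move=> n; apply/measurable_EFinP; apply: measurable_funM.
  - by move=> n x _; rewrite lee_fin mulr_ge0.
  - move=> x _ a b ab; rewrite lee_fin ler_wpM2r//.
    exact/lefP/nd_nnsfun_approx.
congr (limn _); apply/funext => n.
have hxE x : (h n x)%:E =
    \sum_(y \in range (h n)) (y * \1_(h n @^-1` [set y]) x)%:E.
  by rewrite fimfunE -fsumEFin.
rewrite (eq_integral _ _ (fun x _ => hxE x)).
rewrite ge0_integral_fsum//; last 2 first.
- by move=> r; exact/measurable_EFinP/measurableT_comp.
- by move=> r x _; rewrite nnfun_muleindic_ge0.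
transitivity (\int[mu]_x
    \sum_(y \in range (h n)) (y * \1_(h n @^-1` [set y]) x)%:E * (w x)%:E); last first.
  apply: eq_integral => x _.
  by rewrite EFinM (hxE x) ge0_mule_fsuml// => y; exact: nnfun_muleindic_ge0.
rewrite ge0_integral_fsum//; last 2 first.
- by move=> r; apply: emeasurable_funM; apply/measurable_EFinP => //;
    exact: measurableT_comp.
- by move=> r x _; apply: mule_ge0; [exact: nnfun_muleindic_ge0|rewrite lee_fin].
apply: eq_fsbigr => r rhn.
have r0 : (0 <= r)%R by move: rhn; rewrite inE => -[t _ <-].
have mI : measurable (h n @^-1` [set r]) by [].
under eq_integral do rewrite EFinM.
rewrite integralZl_indic_nnsfun// integral_indic//.
under [RHS]eq_integral do rewrite EFinM -muleA.
rewrite ge0_integralZl//; last 2 first.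
- by apply: emeasurable_funM; apply/measurable_EFinP.
- by move=> x _; rewrite mule_ge0 ?lee_fin.
congr (_ * _); rewrite setIT /= /density integral_mkcond.
apply: eq_integral => x _; rewrite patchE indicE.
by case: ifPn => xh; rewrite ?mul1e ?mul0e.
Qed.

(** The integral is the difference of those of the positive and negative parts, and multiplication
    by [w >= 0] commutes with taking these parts; hence measurability of [f] is enough. *)
Lemma integral_density (f : T -> R) : measurable_fun setT f ->
  \int[density mu mw w0]_x (f x)%:E = \int[mu]_x (f x * w x)%:E.
Proof.
move=> mf; rewrite [LHS]integralE [in RHS]integralE.
have pE : (fun x => (f x)%:E)^\+ = EFin \o f^\+%R.
  by apply/funext => x; rewrite /= funeposE /funrpos EFin_max.
have nE : (fun x => (f x)%:E)^\- = EFin \o f^\-%R.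
  by apply/funext => x; rewrite /= funenegE /funrneg -EFinN EFin_max.
rewrite pE nE /= !ge0_integral_density//; last 2 first.
- exact: measurable_funrneg.
- exact: measurable_funrpos.
congr (_ - _); apply: eq_integral => x _.
  by rewrite funeposE /funrpos -EFin_max maxr_pMl// mul0r.
by rewrite funenegE /funrneg -EFinN -EFin_max -mulNr maxr_pMl// mul0r.
Qed.

End integral_density.

(** * Andreief's identity *)

Section product_integrals.
Context (R : realType).

Lemma Rintegrable_tensor d1 d2 (T1 : measurableType d1) (T2 : measurableType d2)
    (m1 : probability T1 R) (m2 : probability T2 R) (f : T1 -> R) (g : T2 -> R) :
  Rintegrable m1 f -> Rintegrable m2 g ->
  Rintegrable (m1 \x m2)%E (fun z => f z.1 * g z.2) /\
  \int[(m1 \x m2)%E]_z (f z.1 * g z.2) = (\int[m1]_x f x) * (\int[m2]_y g y).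
Proof.
move=> intf intg.
have mf := Rintegrable_measurable intf; have mg := Rintegrable_measurable intg.
have mfg : measurable_fun setT (fun z : T1 * T2 => (f z.1 * g z.2)%:E).
  by apply/measurable_EFinP; apply: measurable_funM; exact: measurableT_comp.
have intfg : Rintegrable (m1 \x m2)%E (fun z => f z.1 * g z.2).
  apply: (integrable12ltyP m1 m2 mfg).2 => /=.
  under eq_integral => x _.
    under eq_integral do rewrite normrM EFinM.
    rewrite ge0_integralZl//; last first.
      by apply/measurable_EFinP; exact: measurableT_comp.
    over.
  have [_ fny] := integrableP _ _ _ intf; have [_ gny] := integrableP _ _ _ intg.
  rewrite ge0_integralZr//; last 2 first.
  - by apply/measurable_EFinP; exact: measurableT_comp.
  - by apply: integral_ge0.
  by apply: lte_mul_pinfty => //; [exact: integral_ge0|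
    rewrite ge0_fin_numE//; exact: integral_ge0].
split=> //; apply: EFin_inj; rewrite -Rintegral_EFin//.
rewrite -(integral12_prod_meas1 intfg) /fubini_F /=.
under eq_integral => x _.
  under eq_integral do rewrite EFinM.
  rewrite integralZl// Rintegral_EFin//.
  over.
by rewrite integralZr// Rintegral_EFin.
Qed.

Lemma Rintegral_power_measure (mu : probability R R) n (h : 'I_n -> R -> R) :
  (forall i, Rintegrable mu (h i)) ->
  Rintegrable (power_measure mu n) (fun l => \prod_(i < n) h i (tnth l i)) /\
  \int[power_measure mu n]_l (\prod_(i < n) h i (tnth l i)) =
    \prod_(i < n) \int[mu]_x h i x.
Proof.
elim: n h => [|n IH] h inth.
  under eq_fun do rewrite big_ord0.
  under eq_Rintegral do rewrite big_ord0.
  rewrite big_ord0; split.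
    exact: (finite_measure_integrable_cst (power_measure mu 0)).
  rewrite Rintegral_cst// mul1r.
  exact: (congr1 fine (probability_setT (power_measure mu 0))).
have [intH eqH] := IH (fun i => h (lift ord0 i)) (fun i => inth _).
have [intT eqT] := Rintegrable_tensor (inth ord0) intH.
have E : (fun l : n.+1.-tuple R => \prod_(i < n.+1) h i (tnth l i)) \o
    (@tuple_cons _ R n) =
  fun z => h ord0 z.1 * \prod_(i < n) h (lift ord0 i) (tnth z.2 i).
  apply/funext => -[x l] /=; rewrite big_ord_recl; congr (_ * _).
  by apply: eq_bigr => i _; rewrite tnthS.
have mP : measurable_fun setT
    (fun l : n.+1.-tuple R => \prod_(i < n.+1) h i (tnth l i)).
  apply: measurable_prod => i _; apply: measurableT_comp.
    exact: Rintegrable_measurable (inth i).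
  exact: measurable_tnth.
have mPE := (measurable_EFinP _ _).2 mP.
have intP : (mu \x power_measure mu n)%E.-integrable
    (@tuple_cons _ R n @^-1` setT)
    ((EFin \o (fun l : n.+1.-tuple R => \prod_(i < n.+1) h i (tnth l i)))
      \o (@tuple_cons _ R n)).
  by rewrite -compA E preimage_setT.
split.
  exact: (integrable_pushforward (@measurable_tuple_cons _ R n) mPE intP).
rewrite big_ord_recl -eqH -eqT /Rintegral.
rewrite (integral_pushforward (@measurable_tuple_cons _ R n) mPE intP)//.
by rewrite -compA E preimage_setT.
Qed.

End product_integrals.

Section determinantal_integrals.
Context (R : realType) (mu : probability R R) (n : nat) (phi : 'I_n -> R -> R).

(** For orthonormal polynomials the square of this determinant is the squared Vandermonde product up
    to a constant, so it serves as an unnormalized density of the ensemble. *)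
Definition slater (l : n.-tuple R) : R :=
  \det (\matrix_(j < n, i < n) phi i (tnth l j)).

Definition gram (g : R -> R) : 'M[R]_n :=
  \matrix_(a, b) \int[mu]_x (g x * (phi a x * phi b x)).

(** Both determinants are expanded by the Leibniz formula, and each term integrates coordinatewise.
    Each coordinate has its own [h j], so that products (all [h j] equal) and sums (one [h j] equal
    to [f], the others to 1) are both covered. *)
Lemma Rintegral_slater_sq (h : 'I_n -> R -> R) :
  (forall j a b, Rintegrable mu (fun x => h j x * (phi a x * phi b x))) ->
  Rintegrable (power_measure mu n)
    (fun l => (\prod_(j < n) h j (tnth l j)) * slater l ^+ 2) /\
  \int[power_measure mu n]_l ((\prod_(j < n) h j (tnth l j)) * slater l ^+ 2) =
  \sum_(s : 'S_n) \sum_(t : 'S_n)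
    (-1) ^+ s * (-1) ^+ t * \prod_(j < n) gram (h j) (s j) (t j).
Proof.
move=> inth.
pose H (s t : 'S_n) j x := h j x * (phi (s j) x * phi (t j) x).
have E (l : n.-tuple R) : (\prod_(j < n) h j (tnth l j)) * slater l ^+ 2 =
    \sum_(s : 'S_n) \sum_(t : 'S_n)
      (-1) ^+ s * (-1) ^+ t * \prod_(j < n) H s t j (tnth l j).
  rewrite /slater /determinant expr2 big_distrlr/= mulr_sumr.
  apply: eq_bigr => s _; rewrite mulr_sumr; apply: eq_bigr => t _.
  have A (u : 'S_n) : \prod_i (\matrix_(j, i) phi i (tnth l j)) i (u i) =
      \prod_(j < n) phi (u j) (tnth l j).
    by apply: eq_bigr => j _; rewrite mxE.
  by rewrite /H !big_split/= !A [in LHS]mulrACA; exact: mulrCA.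
have intH (s t : 'S_n) := Rintegral_power_measure (fun j => inth j (s j) (t j)).
have intH1 (s t : 'S_n) : Rintegrable (power_measure mu n)
    (fun l => (-1) ^+ s * (-1) ^+ t * \prod_(j < n) H s t j (tnth l j)).
  exact: (RintegrableZl _ (intH s t).1).
have intH2 (s : 'S_n) : Rintegrable (power_measure mu n) (fun l =>
    \sum_(t : 'S_n) (-1) ^+ s * (-1) ^+ t * \prod_(j < n) H s t j (tnth l j)).
  by apply: Rintegrable_sum => t _; exact: intH1.
under eq_fun do rewrite E; under eq_Rintegral do rewrite E.
split; first by apply: Rintegrable_sum => s _; exact: intH2.
rewrite Rintegral_sum//; apply: eq_bigr => s _.
rewrite Rintegral_sum//; apply: eq_bigr => t _.
rewrite (RintegralZl _ _ (intH s t).1)// (intH s t).2; congr (_ * _).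
by apply: eq_bigr => j _; rewrite mxE.
Qed.

Lemma andreief (g : R -> R) :
  (forall a b, Rintegrable mu (fun x => g x * (phi a x * phi b x))) ->
  \int[power_measure mu n]_l ((\prod_(j < n) g (tnth l j)) * slater l ^+ 2) =
  n`!%:R * \det (gram g).
Proof.
move=> intg; rewrite (Rintegral_slater_sq (fun=> intg)).2.
rewrite mulr_natl -card_Sn -sumr_const.
apply: eq_big => [s|s _]; first by rewrite inE.
(* With [t = s * u] the signs combine to that of [u], and the product, reindexed by [s], no longer
   depends on [s]: the sum is [n!] copies of the determinant. *)
rewrite (reindex_inj (mulgI s)) /=.
apply: eq_bigr => u _.
rewrite odd_permM signr_addb mulrA -expr2 sqrr_sign mul1r; congr (_ * _).
rewrite [RHS](reindex_inj (@perm_inj _ s)) /=.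
by apply: eq_bigr => j _; rewrite permM.
Qed.

Hypothesis orthonormal_phi : gram (fun=> 1) = 1%:M.

Lemma Rintegral_linstat_slater_sq (f : R -> R) :
  (forall a b, Rintegrable mu (fun x => phi a x * phi b x)) ->
  (forall a b, Rintegrable mu (fun x => f x * (phi a x * phi b x))) ->
  Rintegrable (power_measure mu n) (fun l => linstat f l * slater l ^+ 2) /\
  \int[power_measure mu n]_l (linstat f l * slater l ^+ 2) =
  n`!%:R * \tr (gram f).
Proof.
move=> int1 intf.
pose h (k j : 'I_n) x : R := if j == k then f x else 1.
have inth k j a b : Rintegrable mu (fun x => h k j x * (phi a x * phi b x)).
  rewrite /h; case: (j == k); first exact: intf.
  by under eq_fun do rewrite mul1r; exact: int1.
have E (l : n.-tuple R) : linstat f l * slater l ^+ 2 =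
    \sum_(k < n) (\prod_(j < n) h k j (tnth l j)) * slater l ^+ 2.
  rewrite mulr_suml; apply: eq_bigr => k _; congr (_ * _).
  rewrite (bigD1 k)//= /h eqxx big1 ?mulr1// => j /negPf->//.
under eq_fun do rewrite E; under eq_Rintegral do rewrite E.
split; first by apply: Rintegrable_sum => k _; exact: (Rintegral_slater_sq (inth k)).1.
rewrite Rintegral_sum; last by move=> k _; exact: (Rintegral_slater_sq (inth k)).1.
transitivity (\sum_(k < n) \sum_(s : 'S_n) gram f (s k) (s k)).
  apply: eq_bigr => k _; rewrite (Rintegral_slater_sq (inth k)).2.
  apply: eq_bigr => s _; rewrite (bigD1 s)//= [X in _ + X]big1 ?addr0 => [|t ts].
    rewrite -expr2 sqrr_sign mul1r (bigD1 k)//= [X in _ * X]big1 ?mulr1.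
      by rewrite /h eqxx.
    by move=> j /negPf jk; rewrite /h jk orthonormal_phi mxE eqxx.
  (* Distinct permutations cannot differ at [k] alone. Some [j != k] thus contributes an
     off-diagonal entry of the identity matrix, which kills the term. *)
  have [j /andP[jk stj]] : exists j, (j != k) && (s j != t j).
    apply/existsP; apply: contraNT ts => /existsPn st; apply/eqP.
    have st' j : j != k -> t j = s j.
      by move=> jk; have := st j; rewrite jk/= negbK => /eqP.
    apply/permP => j; have [->|/st'//] := eqVneq j k.
    pose i := (s^-1)%g (t k).
    have si : s i = t k by rewrite /i permKV.
    have [ik|/st' ik] := eqVneq i k; first by rewrite -si ik.
    by move: si; rewrite -ik => /perm_inj ik'; rewrite -ik' ik.
  rewrite (bigD1 j)//= /h (negPf jk) orthonormal_phi mxE (negPf stj).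
  by rewrite mul0r mulr0.
rewrite exchange_big/= mulr_natl -card_Sn -sumr_const.
by apply: eq_big => [s|s _]; rewrite ?inE// /mxtrace [RHS](reindex_inj (@perm_inj _ s)).
Qed.

End determinantal_integrals.

(** * Orthonormal polynomials *)

Section polynomial_inner_product.
Context (R : realType) (mu : probability R R).
Hypothesis mom : finite_moments mu.
Implicit Types p q : {poly R}.

Lemma measurable_horner p : measurable_fun setT (horner p).
Proof. by apply: continuous_measurable_fun; exact: continuous_horner. Qed.

Lemma Rintegrable_poly p : Rintegrable mu (fun x => p.[x]).
Proof.
under eq_fun do rewrite horner_coef.
by apply: Rintegrable_sum => i _; apply: RintegrableZl; exact: mom.
Qed.

Lemma Rintegrable_polyM p q : Rintegrable mu (fun x => p.[x] * q.[x]).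
Proof. by under eq_fun do rewrite -hornerM; exact: Rintegrable_poly. Qed.

Definition ip p q : R := \int[mu]_x (p.[x] * q.[x]).

Lemma ipC p q : ip p q = ip q p.
Proof. by apply: eq_Rintegral => x _; rewrite mulrC. Qed.

Lemma ipDl p1 p2 q : ip (p1 + p2) q = ip p1 q + ip p2 q.
Proof.
rewrite -RintegralD//; [|exact: Rintegrable_polyM..].
by apply: eq_Rintegral => x _; rewrite hornerD mulrDl.
Qed.

Lemma ipZl a p q : ip (a *: p) q = a * ip p q.
Proof.
rewrite -RintegralZl//; last exact: Rintegrable_polyM.
by apply: eq_Rintegral => x _; rewrite hornerZ mulrA.
Qed.

Lemma ip_suml I (s : seq I) (P : pred I) (F : I -> {poly R}) q :
  ip (\sum_(i <- s | P i) F i) q = \sum_(i <- s | P i) ip (F i) q.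
Proof.
rewrite -Rintegral_sum; last by move=> i _; exact: Rintegrable_polyM.
by apply: eq_Rintegral => x _; rewrite horner_sum mulr_suml.
Qed.

Hypothesis supp : infinite_set (msupport mu).

(** If the integral of [p^2] vanished, the open set where [p] is nonzero would be null and so would
    miss the support; the infinite support would then consist of roots of [p]. *)
Lemma ip_gt0 p : p != 0 -> 0 < ip p p.
Proof.
move=> p0; rewrite lt_neqAle andbC Rintegral_ge0/=; last first.
  by move=> x _; rewrite -expr2 sqr_ge0.
apply/eqP => /esym ip0.
have ip0' : \int[mu]_x (p.[x] * p.[x]) = 0 by exact: ip0.
have : (\int[mu]_x `|(p.[x] * p.[x])%:E|)%E = 0%E.
  under eq_integral => x _ do rewrite gee0_abs ?lee_fin -?expr2 ?sqr_ge0// expr2.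
  by rewrite Rintegral_EFin; [rewrite ip0'|exact: Rintegrable_polyM].
have mpp : measurable_fun setT (fun x => (p.[x] * p.[x])%:E).
  by apply/measurable_EFinP; apply: measurable_funM; exact: measurable_horner.
move=> /(ae_eq_integral_abs mu measurableT mpp).1 pp0.
pose U := [set x | p.[x] != 0].
have oU : open U.
  apply: (open_comp (f := horner p) (D := [set y | y != 0])).
    by move=> x _; exact: continuous_horner.
  exact: open_neq.
have mU : measurable U by exact: open_measurable.
have U0 : mu U = 0%E.
  apply/negligibleP => //; apply: negligibleS pp0 => x /= px.
  by move=> /(_ I) [] /eqP; rewrite mulf_eq0 orbb (negPf px).
have [B BS sB] := infinite_set_fset (size p) supp.
suff : (size (finmap.enum_fset B) < size p)%N by rewrite ltnNge sB.
apply: max_poly_roots => //; last exact: finmap.fset_uniq.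
apply/allP => x xB; apply: contraT => px.
by have := BS x xB U oU px; rewrite U0 ltxx.
Qed.

(** The recursion runs on the list of all previous polynomials, since each new one depends on all of
    them. Starting from a monic monomial makes the leading coefficients positive. *)
Definition gram_schmidt_step (s : seq {poly R}) : {poly R} :=
  let q := 'X^(size s) - \sum_(p <- s) ip 'X^(size s) p *: p in
  (Num.sqrt (ip q q))^-1 *: q.

Definition gram_schmidt n : seq {poly R} :=
  iter n (fun s => rcons s (gram_schmidt_step s)) [::].

Lemma gram_schmidtE n :
  gram_schmidt n = [seq gram_schmidt_step (gram_schmidt i) | i <- iota 0 n].
Proof.
elim: n => // n IH; rewrite -addn1 iotaD map_cat -IH addn1 cats1.
by rewrite [LHS]/= add0n.
Qed.

Lemma orthonormal_polys_exist : exists p : nat -> {poly R}, orthonormal_polys mu p.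
Proof.
pose p n : {poly R} := gram_schmidt_step (gram_schmidt n).
pose q n : {poly R} := 'X^n - \sum_(i < n) ip 'X^n (p i) *: p i.
have pE n : p n = (Num.sqrt (ip (q n) (q n)))^-1 *: q n.
  rewrite /p {1}/gram_schmidt_step; have -> : size (gram_schmidt n) = n.
    by rewrite gram_schmidtE size_map size_iota.
  rewrite [in LHS]gram_schmidtE big_map -[n in iota 0 n]subn0.
  by rewrite -/(index_iota _ _) big_mkord.
have H n : (size (p n) = n.+1 /\ 0 < lead_coef (p n)) /\
    (forall i, (i < n)%N -> ip (p n) (p i) = 0) /\ ip (p n) (p n) = 1.
  elim/ltn_ind: n => n IH.
  have s_lt : (size (- \sum_(i < n) ip 'X^n (p i) *: p i)
      < size ('X^n : {poly R}))%N.
    rewrite size_polyXn ltnS size_polyN; apply: (leq_trans (size_sum _ _ _)).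
    apply/bigmax_leqP => i _; apply: (leq_trans (size_scale_leq _ _)).
    by rewrite (IH i (ltn_ord i)).1.1.
  have sq : size (q n) = n.+1 by rewrite size_polyDl// size_polyXn.
  have lq : lead_coef (q n) = 1 by rewrite lead_coefDl// lead_coefXn.
  have q0 : q n != 0 by rewrite -size_poly_eq0 sq.
  have c0 : 0 < Num.sqrt (ip (q n) (q n)) by rewrite sqrtr_gt0 ip_gt0.
  split; [split|split].
  - by rewrite pE size_scale// invr_eq0 gt_eqF.
  - by rewrite pE lead_coefZ lq mulr1 invr_gt0.
  - move=> i ltin; rewrite pE ipZl.
    suff -> : ip (q n) (p i) = 0 by rewrite mulr0.
    rewrite /q ipDl -scaleN1r ipZl ip_suml.
    rewrite (bigD1 (Ordinal ltin))//= ipZl (IH i ltin).2.2 mulr1.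
    rewrite big1 ?addr0 ?mulN1r ?subrr// => j ji.
    rewrite ipZl; have [jlti|iltj|ij] := ltngtP j i.
    + by rewrite [ip (p j) _]ipC (IH i ltin).2.1// mulr0.
    + by rewrite (IH j (ltn_ord j)).2.1// mulr0.
    + by move: ji; rewrite -val_eqE/= ij eqxx.
  - rewrite {1}pE ipZl ipC pE ipZl mulrA -invfM -expr2 sqr_sqrtr ?mulVf//.
      by rewrite gt_eqF// ip_gt0.
    by rewrite ltW// ip_gt0.
exists p; split=> [j|i j]; first exact: (H j).1.
rewrite Rintegral_EFin; last exact: Rintegrable_polyM.
rewrite -/(ip (p i) (p j)); congr EFin.
have [ij|ji|->] := ltngtP i j.
- by rewrite ipC (H j).2.1.
- by rewrite (H i).2.1.
- exact: (H j).2.2.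
Qed.

End polynomial_inner_product.

(** * The orthogonal polynomial ensemble *)

Lemma measurable_linstat (R : realType) (f : R -> R) n :
  measurable_fun setT f -> measurable_fun setT (@linstat R f n).
Proof.
move=> mf; apply: measurable_sum => i; apply: measurableT_comp => //.
exact: measurable_tnth.
Qed.

Section ensemble.
Context (R : realType) (mu : probability R R).
Hypothesis adm : admissible mu.

Local Notation p := (orthopoly mu).

Lemma orthopolyP : orthonormal_polys mu p.
Proof.
have [q Hq] := orthonormal_polys_exist adm.1 adm.2.
exact: (xgetI _ Hq).
Qed.

Lemma size_orthopoly j : size (p j) = j.+1.
Proof. exact: (orthopolyP.1 j).1. Qed.

Lemma gamma_gt0 j : 0 < gamma mu j.
Proof. exact: (orthopolyP.1 j).2. Qed.

Lemma ip_orthopoly i j : ip mu (p i) (p j) = (i == j)%:R.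
Proof.
by apply: EFin_inj; rewrite -(orthopolyP.2 i j) Rintegral_EFin//;
  exact: (Rintegrable_polyM adm.1).
Qed.

Section fixed_size.
Variable n : nat.

Definition orthofun (i : 'I_n) (x : R) : R := (p i).[x].

Lemma Rintegrable_orthofun (f : R -> R) (B : R) (i j : 'I_n) : measurable_fun setT f ->
  (forall x, `|f x| <= B) ->
  Rintegrable mu (fun x => f x * (orthofun i x * orthofun j x)).
Proof.
move=> mf fB; apply: (RintegrableMl mf fB).
exact: (Rintegrable_polyM adm.1).
Qed.

Lemma gram1 : gram mu orthofun (fun=> 1) = 1%:M.
Proof.
apply/matrixP => i j; rewrite !mxE -val_eqE/= -ip_orthopoly.
by apply: eq_Rintegral => x _; rewrite mul1r.
Qed.

(** The matrix of the values of the [p i] is a Vandermonde matrix times the coefficient matrix,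
    which is triangular with diagonal entries [gamma mu i]. *)
Lemma slater_sqE (l : n.-tuple R) :
  slater orthofun l ^+ 2 = (\prod_(i < n) gamma mu i) ^+ 2 * vandermonde_sq l.
Proof.
pose L : 'M[R]_n := \matrix_(i, k) (p i)`_k.
pose V := Vandermonde n (\row_j tnth l j).
have -> : slater orthofun l = \det V * \det L.
  rewrite mulrC -det_mulmx -det_tr; congr (\det _).
  apply/matrixP => i j; rewrite !mxE /orthofun.
  rewrite (@horner_coef_wide _ n) ?size_orthopoly//.
  by apply: eq_bigr => k _; rewrite !mxE.
rewrite exprMn mulrC; congr (_ ^+ 2 * _).
  rewrite det_trig; first by apply: eq_bigr => i _; rewrite mxE /gamma lead_coefE size_orthopoly.
  apply/is_trig_mxP => i j ij; rewrite mxE nth_default//.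
  by rewrite size_orthopoly.
rewrite det_Vandermonde -prodrXl /vandermonde_sq.
rewrite [RHS](exchange_big_dep xpredT)//=.
apply: eq_bigr => i _; rewrite -prodrXl.
by apply: eq_bigr => j _; rewrite !mxE.
Qed.

Lemma measurable_slater_sq :
  measurable_fun setT (fun l => slater orthofun l ^+ 2 / n`!%:R).
Proof.
under eq_fun do rewrite slater_sqE.
do 2 apply: measurable_funM => //.
exact: measurable_vandermonde_sq.
Qed.

Lemma slater_sq_ge0 l : 0 <= slater orthofun l ^+ 2 / n`!%:R.
Proof. by rewrite divr_ge0// sqr_ge0. Qed.

(** Andreief's identity with [g = 1] gives Z_n = n! divided by the squared product of the leading
    coefficients. *)
Lemma OPE_slater (S : set (n.-tuple R)) : measurable S ->
  OPE mu n S = density (power_measure mu n) measurable_slater_sq slater_sq_ge0 S.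
Proof.
move=> mS.
set c := (\prod_(i < n) gamma mu i) ^+ 2.
have c0 : 0 < c by rewrite exprn_gt0// prodr_gt0// => i _; exact: gamma_gt0.
have vE (l : n.-tuple R) : vandermonde_sq l = c^-1 * slater orthofun l ^+ 2.
  by rewrite slater_sqE mulKf// gt_eqF.
have n0 : (0 : R) < n`!%:R by rewrite ltr0n fact_gt0.
have int1 a b : Rintegrable mu (fun x => 1 * (orthofun a x * orthofun b x)).
  by apply: (@Rintegrable_orthofun _ 1) => // x; rewrite normr1.
have intS := (Rintegral_slater_sq (fun=> int1)).1.
have Z : density (power_measure mu n) (@measurable_vandermonde_sq R n)
    (@vandermonde_sq_ge0 R n) setT = (c^-1 * n`!%:R)%:E.
  have vE' (l : n.-tuple R) :
      vandermonde_sq l = c^-1 * ((\prod_(j < n) 1) * slater orthofun l ^+ 2).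
    by rewrite big1_eq mul1r.
  rewrite /density; under eq_integral do rewrite vE'.
  rewrite Rintegral_EFin; last exact: RintegrableZl.
  congr EFin; rewrite RintegralZl// (andreief int1) gram1 det1 mulr1//.
rewrite /OPE /= /mnormalize /= Z.
(* The normalizing constant is positive and finite, so the default branch of [mnormalize] is not
   taken. *)
rewrite ifF; last by apply/negbTE; rewrite negb_or/= eqe gt_eqF// mulr_gt0 ?invr_gt0.
rewrite /density muleC -ge0_integralZl//=.
- apply: eq_integral => l _; rewrite -EFinM vE; congr EFin.
  by rewrite invfM invrK mulrACA mulfV ?gt_eqF// mul1r mulrC.
- by apply/measurable_EFinP; apply: measurable_funTS; exact: measurable_vandermonde_sq.
- by move=> l _; rewrite lee_fin vandermonde_sq_ge0.
- by rewrite lee_fin invr_ge0 ltW// mulr_gt0 ?invr_gt0.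
Qed.

(** Markov's inequality for a product statistic, whose expectation is a determinant by Andreief's
    identity. *)
Lemma OPE_le_det (g : R -> R) (B a : R) (S : set (n.-tuple R)) :
  measurable S -> measurable_fun setT g -> (forall x, 0 <= g x <= B) -> 0 <= a ->
  (forall l, S l -> 1 <= a * \prod_(j < n) g (tnth l j)) ->
  (OPE mu n S <= (a * \det (gram mu orthofun g))%:E)%E.
Proof.
move=> mS mg gB a0 Sg.
have n0 : (0 : R) < n`!%:R by rewrite ltr0n fact_gt0.
have intg i j : Rintegrable mu (fun x => g x * (orthofun i x * orthofun j x)).
  apply: (@Rintegrable_orthofun _ B) => // x.
  by have /andP[g0 ?] := gB x; rewrite ger0_norm.
have intP := (Rintegral_slater_sq (fun=> intg)).1.
pose h (l : n.-tuple R) :=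
  a / n`!%:R * ((\prod_(j < n) g (tnth l j)) * slater orthofun l ^+ 2).
have inth : Rintegrable (power_measure mu n) h by exact: RintegrableZl.
have h0 l : 0 <= h l.
  apply: mulr_ge0; first by rewrite divr_ge0.
  apply: mulr_ge0; last exact: sqr_ge0.
  by apply: prodr_ge0 => j _; have /andP[] := gB (tnth l j).
have -> : (a * \det (gram mu orthofun g))%:E = (\int[power_measure mu n]_l (h l)%:E)%E.
  rewrite Rintegral_EFin// RintegralZl// (andreief intg); congr EFin.
  by rewrite mulrA divfK// gt_eqF.
have mh := Rintegrable_measurable inth.
rewrite OPE_slater// /density.
apply: (@le_trans _ _ (\int[power_measure mu n]_(l in S) (h l)%:E)%E).
  apply: ge0_le_integral => //.
  - by move=> l _; rewrite lee_fin slater_sq_ge0.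
  - by apply/measurable_EFinP/measurable_funTS; exact: measurable_slater_sq.
  - by apply/measurable_EFinP/measurable_funTS.
  - move=> l Sl; rewrite lee_fin /h mulrACA [_^-1 * _]mulrC.
    by rewrite ler_peMl ?slater_sq_ge0// Sg.
apply: ge0_subset_integral => //; last by move=> l _; rewrite lee_fin.
exact/measurable_EFinP.
Qed.

Lemma mean_linstatE (f : R -> R) B : measurable_fun setT f ->
  (forall x, `|f x| <= B) -> mean_linstat mu n f = \tr (gram mu orthofun f).
Proof.
move=> mf fB.
have n0 : (0 : R) < n`!%:R by rewrite ltr0n fact_gt0.
have mlin := measurable_linstat (n := n) mf.
rewrite /mean_linstat unlock.
rewrite (eq_measure_integral (density (power_measure mu n)
  measurable_slater_sq slater_sq_ge0)); last first.
  by move=> A mA _; exact: OPE_slater.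
rewrite integral_density// -/(Rintegral _ _ _).
have int1 a b : Rintegrable mu (fun x => orthofun a x * orthofun b x).
  exact: (Rintegrable_polyM adm.1).
have intf a b : Rintegrable mu (fun x => f x * (orthofun a x * orthofun b x)).
  exact: Rintegrable_orthofun.
have E (l : n.-tuple R) : linstat f l * (slater orthofun l ^+ 2 / n`!%:R) =
    n`!%:R^-1 * (linstat f l * slater orthofun l ^+ 2).
  by rewrite mulrA mulrC.
under eq_Rintegral do rewrite E.
have [intl eql] := Rintegral_linstat_slater_sq gram1 int1 intf.
by rewrite RintegralZl// eql mulKf// gt_eqF.
Qed.

End fixed_size.
End ensemble.

(** * Real quadratic forms and the complex spectral theorem *)

Section real_forms_of_complex_vectors.
Context (R : rcfType).
Local Open Scope complex_scope.
Local Notation C := R[i].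

(* The real part of w X w^* for the complex row w = u + iv. *)
Definition quad_form n (X : 'M[R]_n) (u v : 'rV[R]_n) : R :=
  \sum_a \sum_b X a b * (u 0 a * u 0 b + v 0 a * v 0 b).

Local Notation cmx X := (map_mx (real_complex R) X).
Local Notation "M ^t*" := (map_mx Num.conj M^T).

Lemma conj_complexE (z : C) : Num.conj z = conjc z.
Proof. by []. Qed.

Definition rowRe n (w : 'rV[C]_n) : 'rV[R]_n := map_mx (@complex.Re R) w.
Definition rowIm n (w : 'rV[C]_n) : 'rV[R]_n := map_mx (@complex.Im R) w.

Lemma ReE_sum I (s : seq I) (P : pred I) (F : I -> C) :
  complex.Re (\sum_(i <- s | P i) F i) = \sum_(i <- s | P i) complex.Re (F i).
Proof. exact: (raddf_sum (@complex.Re R : Rcomplex R -> R)). Qed.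

Lemma Re_quad_form n (X : 'M[R]_n) (w : 'rV[C]_n) :
  complex.Re ((w *m cmx X *m w^t*) 0 0) = quad_form X (rowRe w) (rowIm w).
Proof.
rewrite mxE ReE_sum /quad_form [RHS]exchange_big/=; apply: eq_bigr => b _.
rewrite !mxE mulr_suml ReE_sum; apply: eq_bigr => a _.
rewrite !mxE conj_complexE; case: (w 0 a) => x y; case: (w 0 b) => z t /=.
by rewrite !(mulr0, mul0r, subr0, add0r, addr0) mulrN opprK mulrDr !mulrA (mulrC x) (mulrC y).
Qed.

Section spectral_quad_form.
Variables (n : nat) (F : 'M[R]_n).
Hypothesis symF : F^T = F.
Let U : 'M[C]_n := spectralmx (cmx F).

Lemma cmx_hermitian (G : 'M[R]_n) : G^T = G -> cmx G \is hermsymmx.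
Proof.
move=> symG; apply/is_hermitianmxP; rewrite expr0 scale1r.
apply/matrixP => i j; rewrite !mxE conj_complexE conjc_real.
by rewrite -{1}symG mxE.
Qed.


Lemma cmx_congr_hermitian (B : 'M[C]_n) (G : 'M[R]_n) : G^T = G ->
  B *m cmx G *m B^t* \is hermsymmx.
Proof.
move=> symG; apply/is_hermitianmxP; rewrite expr0 scale1r.
have := is_hermitianmxP _ _ _ (cmx_hermitian symG); rewrite expr0 scale1r => hG.
have BB : (B^t*)^t* = B by apply/matrixP => i j; rewrite !mxE; exact: conjcK.
by rewrite !trmx_mul !map_mxM BB -hG mulmxA.
Qed.

Lemma quad_form_psd (G : 'M[R]_n) (u v : 'rV[R]_n) :
  (forall x : 'rV[R]_n, 0 <= \sum_a \sum_b x 0 a * G a b * x 0 b) ->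
  0 <= quad_form G u v.
Proof.
move=> G0.
have -> : quad_form G u v = \sum_a \sum_b u 0 a * G a b * u 0 b +
    \sum_a \sum_b v 0 a * G a b * v 0 b.
  rewrite -big_split; apply: eq_bigr => a _; rewrite -big_split.
  by apply: eq_bigr => b _ /=; rewrite mulrDr !mulrA !(mulrC (G a b)).
by rewrite addr_ge0.
Qed.

Lemma hermitian_spectral (H : 'M[C]_n) : H \is hermsymmx ->
  let W := spectralmx H in exists lam : 'rV[R]_n,
  [/\ W *m W^t* = 1%:M, W^t* *m W = 1%:M &
      W *m H *m W^t* = diag_mx (map_mx (real_complex R) lam)].
Proof.
move=> hermH W.
have Wu : W \is unitarymx := spectral_unitarymx H.
have WW : W *m W^t* = 1%:M by exact/unitarymxP.
have WW' : W^t* *m W = 1%:M by exact: mulmx1C.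
exists (map_mx (@complex.Re R) (spectral_diag H)); split => //.
have realD := hermitian_spectral_diag_real hermH.
have -> : map_mx (real_complex R) (map_mx (@complex.Re R) (spectral_diag H)) =
    spectral_diag H.
  by apply/matrixP => i j; rewrite !mxE RRe_real//; exact: (mxOverP realD).
have /orthomx_spectralP := hermitian_normalmx hermH.
rewrite -/W (invmx_unitary Wu) => {1}->.
by rewrite !mulmxA WW mul1mx -mulmxA WW mulmx1.
Qed.

Lemma mxtrace_unitary (W A : 'M[C]_n) : W^t* *m W = 1%:M ->
  \tr (W *m A *m W^t*) = \tr A.
Proof. by move=> WW; rewrite -mulmxA mxtrace_mulC -mulmxA WW mulmx1. Qed.

Lemma Re_mxtrace (A : 'M[C]_n) :
  complex.Re (\tr A) = \sum_i complex.Re (A i i).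
Proof. exact: ReE_sum. Qed.

Lemma row_conj_entry (W A : 'M[C]_n) i :
  (W *m A *m W^t*) i i = (row i W *m A *m (row i W)^t*) 0 0.
Proof.
rewrite -row_mul; rewrite !mxE; apply: eq_bigr => j _.
by rewrite !mxE.
Qed.

(* The [d i] are the eigenvalues of [F], with eigenvectors [u i + i v i] forming
   the rows of a unitary matrix [U]; the [lam i] are the eigenvalues of
   [D U G U^* D], where [D] is the diagonal matrix of the [sqrt (r i)]. *)
Lemma spectral_quad_form : exists (d : 'I_n -> R) (u v : 'I_n -> 'rV[R]_n),
  [/\ forall i, quad_form 1%:M (u i) (v i) = 1,
      forall i, quad_form F (u i) (v i) = d i,
      forall X : 'M[R]_n, \sum_i quad_form X (u i) (v i) = \tr X,
      \sum_i d i ^+ 2 = \sum_a \sum_b F a b ^+ 2 &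
      forall (G : 'M[R]_n) (r : 'I_n -> R), G^T = G ->
        (forall x : 'rV[R]_n, 0 <= \sum_a \sum_b x 0 a * G a b * x 0 b) ->
        (forall i, 0 <= r i) ->
        exists lam : 'I_n -> R, [/\ forall i, 0 <= lam i,
          \prod_i lam i = \prod_i r i * \det G &
          \sum_i lam i = \sum_i r i * quad_form G (u i) (v i)]].
Proof.
have [lam [UU UU' UF]] := hermitian_spectral (cmx_hermitian symF).
rewrite -/U in UU UU' UF.
exists (lam 0), (fun i => rowRe (row i U)), (fun i => rowIm (row i U)).
have trE (X : 'M[R]_n) :
    \sum_i quad_form X (rowRe (row i U)) (rowIm (row i U)) = \tr X.
  under eq_bigr do rewrite -Re_quad_form -row_conj_entry.
  rewrite -Re_mxtrace mxtrace_unitary// Re_mxtrace.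
  by apply: eq_bigr => i _; rewrite mxE.
split=> //.
- by move=> i; rewrite -Re_quad_form -row_conj_entry map_mx1 mulmx1 UU mxE eqxx.
- by move=> i; rewrite -Re_quad_form -row_conj_entry UF !mxE eqxx mulr1n.
(* Both sums are the trace of F^2: one by unitary invariance, the other by symmetry of [F]. *)
- transitivity (\tr (F *m F)); last first.
    apply: eq_bigr => a _; rewrite mxE; apply: eq_bigr => b _.
    by rewrite -{2}symF mxE expr2.
  rewrite -trE; apply: eq_bigr => i _.
  rewrite -Re_quad_form -row_conj_entry map_mxM.
  have -> : U *m (cmx F *m cmx F) *m U^t* =
      (U *m cmx F *m U^t*) *m (U *m cmx F *m U^t*).
    by rewrite -!mulmxA [U^t* *m (U *m _)]mulmxA UU' mul1mx.
  rewrite UF mulmx_diag !mxE eqxx mulr1n.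
  by rewrite -rmorphM/= expr2.
- move=> G r symG psdG r0.
  pose s : 'rV[C]_n := \row_i (Num.sqrt (r i))%:C.
  have [B BE] : exists B, B = diag_mx s *m U by exists (diag_mx s *m U).
  have Bt : B^t* = U^t* *m diag_mx s.
    rewrite BE trmx_mul map_mxM tr_diag_mx; congr (_ *m _).
    apply/matrixP => i j; rewrite !mxE; case: eqP => _; last by rewrite !mulr0n rmorph0.
    rewrite !mulr1n; exact: conjc_real.
  have [H HE] : exists H, H = B *m cmx G *m B^t* by exists (B *m cmx G *m B^t*).
  have hermH : H \is hermsymmx.
    by rewrite HE; exact: cmx_congr_hermitian.
  have [la [WW WW' WH]] := hermitian_spectral hermH.
  set W := spectralmx H in WW WW' WH.
  exists (la 0); split.
  + move=> i; have -> : la 0 i = complex.Re ((W *m H *m W^t*) i i).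
      by rewrite WH !mxE eqxx mulr1n.
    (* Each eigenvalue is the quadratic form of [G] at a row of [W *m B], hence nonnegative. *)
    have -> : W *m H *m W^t* = (W *m B) *m cmx G *m (W *m B)^t*.
      by rewrite (trmx_mul W B) map_mxM HE !mulmxA.
    by rewrite row_conj_entry Re_quad_form quad_form_psd.
  + apply: (@complexI R); rewrite rmorph_prod/=.
    transitivity (\det (W *m H *m W^t*)).
      by rewrite WH det_diag; apply: eq_bigr => i _; rewrite mxE.
    rewrite !det_mulmx mulrAC -det_mulmx WW det1 mul1r HE Bt BE !det_mulmx det_map_mx !det_diag.
    rewrite rmorphM rmorph_prod/=.
    have -> : \prod_i (r i)%:C = (\prod_i s 0 i) * (\prod_i s 0 i).
      rewrite -big_split/=; apply: eq_bigr => i _; rewrite mxE -rmorphM/=.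
      by rewrite -expr2 sqr_sqrtr.
    have dU : \det U * \det (U^t*) = 1 by rewrite -det_mulmx UU det1.
    rewrite -[RHS]mulr1 -[X in _ = _ * X]dU.
    move: (\prod_i s 0 i) (\det U) (\det (U^t*)) (\det G)%:C => a x y z.
    by ring.
  + transitivity (complex.Re (\tr (W *m H *m W^t*))).
      rewrite Re_mxtrace; apply: eq_bigr => i _.
      by rewrite WH !mxE eqxx mulr1n.
    (* The trace does not see [W], and conjugating by the square roots of the [r i] multiplies the
       diagonal entry [i] by [r i]. *)
    rewrite mxtrace_unitary// Re_mxtrace; apply: eq_bigr => i _.
    rewrite -Re_quad_form -row_conj_entry HE Bt BE.
    have -> : diag_mx s *m U *m cmx G *m (U^t* *m diag_mx s) =
      diag_mx s *m (U *m cmx G *m U^t*) *m diag_mx s by rewrite !mulmxA.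
    rewrite mul_diag_mx mul_mx_diag !mxE.
    move: (\sum_j _) => z; rewrite mulrAC -rmorphM/= -expr2 sqr_sqrtr//.
    by case: z => x y /=; rewrite mul0r subr0.
Qed.

End spectral_quad_form.
End real_forms_of_complex_vectors.

(** * Laplace transform and concentration *)

Section exponential_inequalities.
Context (R : realType).

(** From exp(s) <= 1 / (1 - s) and (1 + s + 3 s^2)(1 - s) = 1 + s^2 (2 - 3 s); the last factor is
    nonnegative exactly for s <= 2/3. *)
Lemma expR_le_quadratic (s : R) : `|s| <= 2 / 3 -> expR s <= 1 + s + 3 * s ^+ 2.
Proof.
rewrite ler_norml => /andP[s1 s2].
have s0 : 0 < 1 - s by lra.
have : expR s <= (1 - s)^-1.
  rewrite -[expR s]invrK lef_pV2 ?posrE ?invr_gt0 ?expR_gt0//.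
  by rewrite -expRN expR_ge1Dx.
move=> /le_trans; apply; rewrite -[_^-1]mul1r ler_pdivrMr//.
nra.
Qed.

(** Each factor satisfies x <= exp(x - 1). Applied to eigenvalues, this is the bound of a
    determinant by a trace. *)
Lemma prod_le_expR (I : finType) (lam : I -> R) : (forall i, 0 <= lam i) ->
  \prod_i lam i <= expR (\sum_i lam i - #|I|%:R).
Proof.
move=> lam0; rewrite -sumr_const -sumrB expR_sum.
apply: ler_prod => i _; rewrite lam0/=.
by apply: le_trans (expR_ge1Dx _); rewrite addrC subrK.
Qed.

End exponential_inequalities.

Section laplace_transform.
Context (R : realType) (mu : probability R R).
Hypothesis adm : admissible mu.
Variable n : nat.

Local Notation phi := (@orthofun R mu n).
Local Notation G := (gram mu phi).

(* The variance of the linear statistic, tr(P f^2 P) - tr((P f P)^2) for the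
   projection P onto the polynomials of degree less than n. *)
Definition linstat_var (f : R -> R) : R :=
  \tr (G (fun x => f x ^+ 2)) - \sum_a \sum_b G f a b ^+ 2.

(** The squared modulus of the polynomial with complex coefficients [u + i v] in the orthonormal
    basis. *)
Definition quad_weight (u v : 'rV[R]_n) (x : R) : R :=
  (\sum_a u 0 a * phi a x) ^+ 2 + (\sum_a v 0 a * phi a x) ^+ 2.

Lemma quad_weight_ge0 u v x : 0 <= quad_weight u v x.
Proof. by rewrite addr_ge0// sqr_ge0. Qed.

Lemma quad_weightE u v x : quad_weight u v x =
  \sum_a \sum_b (u 0 a * u 0 b + v 0 a * v 0 b) * (phi a x * phi b x).
Proof.
rewrite /quad_weight !expr2 !big_distrlr/= -big_split; apply: eq_bigr => a _.
rewrite -big_split; apply: eq_bigr => b _ /=.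
by rewrite mulrDl; congr (_ + _); exact: mulrACA.
Qed.

Definition bounded_measurable (h : R -> R) :=
  measurable_fun setT h /\ exists B, forall x, `|h x| <= B.

Lemma Rintegrable_gram h a b : bounded_measurable h ->
  Rintegrable mu (fun x => h x * (phi a x * phi b x)).
Proof. by move=> [mh [B hB]]; exact: (Rintegrable_orthofun adm _ _ mh hB). Qed.

(** Quadratic forms of [G h] become averages of [h] against a nonnegative weight, so pointwise
    inequalities between functions pass to the matrices. *)
Lemma quad_form_gram h u v : bounded_measurable h ->
  Rintegrable mu (fun x => h x * quad_weight u v x) /\
  quad_form (G h) u v = \int[mu]_x (h x * quad_weight u v x).
Proof.
move=> bh.
have E x : h x * quad_weight u v x = \sum_a \sum_b
    (u 0 a * u 0 b + v 0 a * v 0 b) * (h x * (phi a x * phi b x)).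
  rewrite quad_weightE mulr_sumr; apply: eq_bigr => a _.
  by rewrite mulr_sumr; apply: eq_bigr => b _; rewrite mulrCA.
have inth a b := RintegrableZl (u 0 a * u 0 b + v 0 a * v 0 b)
  (Rintegrable_gram a b bh).
have inth2 (a : 'I_n) := @Rintegrable_sum _ _ _ _ _ (index_enum 'I_n) xpredT
  _ (fun b _ => inth a b).
under eq_fun do rewrite E; under eq_Rintegral do rewrite E.
split; first exact: Rintegrable_sum.
rewrite Rintegral_sum//; apply: eq_bigr => a _.
rewrite Rintegral_sum//; apply: eq_bigr => b _.
by rewrite RintegralZl ?mxE 1?mulrC//; exact: Rintegrable_gram.
Qed.

Lemma gram_sym h : (G h)^T = G h.
Proof.
apply/matrixP => a b; rewrite !mxE; apply: eq_Rintegral => x _.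
by rewrite [phi b x * _]mulrC.
Qed.

Lemma gram_psd h (x : 'rV[R]_n) : bounded_measurable h -> (forall x, 0 <= h x) ->
  0 <= \sum_a \sum_b x 0 a * G h a b * x 0 b.
Proof.
move=> bh h0.
have -> : \sum_a \sum_b x 0 a * G h a b * x 0 b = quad_form (G h) x 0.
  apply: eq_bigr => a _; apply: eq_bigr => b _.
  by rewrite [(0 : 'rV__) 0 a]mxE mul0r addr0 mulrAC mulrC.
rewrite (quad_form_gram _ _ bh).2; apply: Rintegral_ge0 => y _.
by rewrite mulr_ge0 ?quad_weight_ge0.
Qed.

Lemma bounded_measurable_cst c : bounded_measurable (fun=> c).
Proof. by split=> //; exists `|c|. Qed.

Section bounded_function.
Variables (f : R -> R) (B : R).
Hypotheses (mf : measurable_fun setT f) (fB : forall x, `|f x| <= B).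

Let bf : bounded_measurable f.
Proof. by split=> //; exists B. Qed.

Let B0 : 0 <= B := le_trans (normr_ge0 _) (fB 0).

Lemma bounded_measurable_sqr : bounded_measurable (fun x => f x ^+ 2).
Proof.
split; first exact: measurable_funX.
exists (B ^+ 2) => x; rewrite normrX ler_sqr ?nnegrE//.
Qed.

Lemma bounded_measurable_expR t : bounded_measurable (fun x => expR (t * f x)).
Proof.
split; first by apply: measurableT_comp => //; exact: measurable_funM.
exists (expR (`|t| * B)) => x.
rewrite ger0_norm ?expR_ge0// ler_expR (le_trans (ler_norm _))//.
by rewrite normrM ler_wpM2l.
Qed.

Lemma det_gram_expR_le (t : R) : `|t| * B <= 3^-1 ->
  expR (- (t * \tr (G f))) * \det (G (fun x => expR (t * f x))) <=
  expR (3 * t ^+ 2 * linstat_var f).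
Proof.
move=> tB.
have [d [u [v [q1 qf trq dd detq]]]] := spectral_quad_form (gram_sym f).
pose w i := quad_weight (u i) (v i).
have int1 i := (quad_form_gram (u i) (v i) (bounded_measurable_cst 1)).1.
have intf i := (quad_form_gram (u i) (v i) bf).1.
have intf2 i := (quad_form_gram (u i) (v i) bounded_measurable_sqr).1.
have inte i := (quad_form_gram (u i) (v i) (bounded_measurable_expR t)).1.
have w1 i : \int[mu]_x (1 * w i x) = 1.
  by rewrite -(quad_form_gram _ _ (bounded_measurable_cst 1)).2 gram1// q1.
have wf i : \int[mu]_x (f x * w i x) = d i.
  by rewrite -(quad_form_gram _ _ bf).2 qf.
have w0 i x : 0 <= w i x by exact: quad_weight_ge0.
(* [d i] is the mean of [f] for the probability density [w i]. *)
have dB i : `|d i| <= B.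
  rewrite -wf; apply: (le_trans (le_normr_Rintegral _ (intf i))) => //.
  rewrite -[leRHS]mulr1 -(w1 i) -(RintegralZl _ _ (int1 i))//.
  apply: le_Rintegral => //.
  - exact: (integrable_norm (intf i)).
  - exact: (RintegrableZl B (int1 i)).
  - by move=> x _; rewrite normrM mul1r (ger0_norm (w0 i x)) ler_wpM2r.
have [lam [lam0 plam slam]] := detq _ (fun i => expR (- (t * d i)))
  (gram_sym _) (fun y => gram_psd y (bounded_measurable_expR t) (fun x => expR_ge0 _))
  (fun i => expR_ge0 _).
have trd : \tr (G f) = \sum_i d i.
  by rewrite -trq; apply: eq_bigr => i _; rewrite qf.
have -> : expR (- (t * \tr (G f))) = \prod_i expR (- (t * d i)).
  by rewrite -expR_sum sumrN -mulr_sumr trd.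
rewrite -plam (le_trans (prod_le_expR lam0))// ler_expR slam card_ord.
rewrite lerBlDr.
have step i : expR (- (t * d i)) * quad_form (G (fun x => expR (t * f x))) (u i) (v i)
    <= 3 * t ^+ 2 * (quad_form (G (fun x => f x ^+ 2)) (u i) (v i) - d i ^+ 2) + 1.
  rewrite (quad_form_gram _ _ (bounded_measurable_expR t)).2.
  rewrite (quad_form_gram _ _ bounded_measurable_sqr).2 -/(w i).
  pose c := 3 * t ^+ 2.
  (* The quadratic bound in [y = t * (f x - d i)] is sorted by powers of [f x], so that only the
     integrals of [w i], [f * w i] and [f^2 * w i] occur. As the second is [d i], the linear term
     cancels. *)
  apply: (@le_trans _ _ (\int[mu]_x ((1 - t * d i + c * d i ^+ 2) * (1 * w i x)
      + ((t - 2 * c * d i) * (f x * w i x) + c * (f x ^+ 2 * w i x))))).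
    rewrite -(RintegralZl _ _ (inte i))//; apply: le_Rintegral => //.
    - exact: (RintegrableZl _ (inte i)).
    - apply: (RintegrableD (RintegrableZl _ (int1 i))).
      exact: (RintegrableD (RintegrableZl _ (intf i)) (RintegrableZl _ (intf2 i))).
    - move=> x _; set y := t * (f x - d i).
      have -> : expR (- (t * d i)) * (expR (t * f x) * w i x) = expR y * w i x.
        by rewrite mulrA -expRD /y mulrBr addrC.
      have -> : (1 - t * d i + c * d i ^+ 2) * (1 * w i x) +
          ((t - 2 * c * d i) * (f x * w i x) + c * (f x ^+ 2 * w i x)) =
          (1 + y + 3 * y ^+ 2) * w i x.
        by rewrite /y /c; ring.
      rewrite ler_wpM2r// expR_le_quadratic//.
      rewrite normrM (le_trans (ler_wpM2l (normr_ge0 t) (ler_normB _ _)))//.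
      rewrite (le_trans (ler_wpM2l (normr_ge0 t) (lerD (fB x) (dB i))))//.
      by rewrite mulrDr; lra.
  rewrite RintegralD//; last 2 first.
  - exact: (RintegrableZl _ (int1 i)).
  - exact: (RintegrableD (RintegrableZl _ (intf i)) (RintegrableZl _ (intf2 i))).
  rewrite RintegralD//; last 2 first.
  - exact: (RintegrableZl _ (intf i)).
  - exact: (RintegrableZl _ (intf2 i)).
  rewrite (RintegralZl _ _ (int1 i))// (RintegralZl _ _ (intf i))//.
  rewrite (RintegralZl _ _ (intf2 i))// w1 wf mulr1 -/c.
  by rewrite le_eqVlt; apply/orP; left; apply/eqP; ring.
rewrite (le_trans (ler_sum _ (fun i _ => step i)))//.
rewrite big_split/= sumr_const card_ord -mulr_sumr sumrB trq dd.
by rewrite lexx.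
Qed.

End bounded_function.
End laplace_transform.

Section concentration.
Context (R : realType) (mu : probability R R).
Hypothesis adm : admissible mu.
Variables (n : nat) (f : R -> R) (B : R).
Hypotheses (mf : measurable_fun setT f) (fB : forall x, `|f x| <= B).

Lemma measurable_linstat_ge (a b c : R) :
  measurable [set l : n.-tuple R | a <= b * (linstat f l - c)].
Proof.
have mh : measurable_fun setT (fun l : n.-tuple R => b * (linstat f l - c)).
  by apply: measurable_funM => //; apply: measurable_funB => //; exact: measurable_linstat.
rewrite (_ : [set _ | _] =
    setT `&` (fun l : n.-tuple R => b * (linstat f l - c)) @^-1` `[a, +oo[).
  by apply: mh => //; exact: measurable_itv.
by rewrite setTI; apply/seteqP; split=> l /=; rewrite in_itv/= andbT.
Qed.

Lemma measurable_linstat_dist_ge (a c : R) :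
  measurable [set l : n.-tuple R | a <= `|linstat f l - c|].
Proof.
have mh : measurable_fun setT (fun l : n.-tuple R => `|linstat f l - c|).
  by apply: measurableT_comp => //; apply: measurable_funB => //; exact: measurable_linstat.
rewrite (_ : [set _ | _] =
    setT `&` (fun l : n.-tuple R => `|linstat f l - c|) @^-1` `[a, +oo[).
  by apply: mh => //; exact: measurable_itv.
by rewrite setTI; apply/seteqP; split=> l /=; rewrite in_itv/= andbT.
Qed.

(** The sign of [t] is free, so one statement serves the upper and the lower tail. *)
Lemma OPE_linstat_chernoff (t s : R) : `|t| * B <= 3^-1 ->
  (OPE mu n [set l | (s <= t * (linstat f l - mean_linstat mu n f))%R]
   <= (expR (- s + 3 * t ^+ 2 * linstat_var mu n f))%:E)%E.
Proof.
move=> tB; set m := mean_linstat mu n f.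
have mE : m = \tr (gram mu (@orthofun R mu n) f) := mean_linstatE adm n mf fB.
have [mg [C gC]] := bounded_measurable_expR mf fB t.
have gC' x : 0 <= expR (t * f x) <= C.
  by rewrite expR_ge0 (le_trans (ler_norm _) (gC x)).
apply: (le_trans (OPE_le_det adm (measurable_linstat_ge _ _ _) mg gC'
  (expR_ge0 (- (s + t * m))) _)).
  move=> l /= sl; rewrite -expR_sum -mulr_sumr -expRD -[leLHS]expR0 ler_expR.
  by move: sl; rewrite /linstat mulrBr; lra.
rewrite lee_fin opprD expRD -mulrA expRD ler_wpM2l ?expR_ge0// mE.
exact: (det_gram_expR_le adm n mf fB tB).
Qed.

Lemma OPE_linstat_concentration (eps t : R) : 0 <= t -> t * B <= 3^-1 ->
  (OPE mu n [set l | (eps <= `|linstat f l - mean_linstat mu n f|)%R]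
   <= (2 * expR (- (t * eps) + 3 * t ^+ 2 * linstat_var mu n f))%:E)%E.
Proof.
move=> t0 tB; set m := mean_linstat mu n f.
have tB1 : `|t| * B <= 3^-1 by rewrite ger0_norm.
have tB2 : `|- t| * B <= 3^-1 by rewrite normrN ger0_norm.
apply: (@le_trans _ _ (OPE mu n ([set l | (t * eps <= t * (linstat f l - m))%R] `|`
    [set l | (t * eps <= - t * (linstat f l - m))%R])%classic)).
  apply: le_measure.
  - apply/mem_set; exact: measurable_linstat_dist_ge.
  - by apply/mem_set; apply: measurableU; exact: measurable_linstat_ge.
  - move=> l /=; rewrite ler_normr => /orP[el|el]; [left|right].
      by rewrite ler_wpM2l.
    by rewrite mulNr -mulrN ler_wpM2l.
apply: (le_trans (measureU2 _ _ _)); [exact: measurable_linstat_ge..|].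
rewrite mulr_natl mulr2n EFinD; apply: leeD; first exact: OPE_linstat_chernoff.
by rewrite -[in leRHS](sqrrN t); exact: OPE_linstat_chernoff.
Qed.

Lemma OPE_linstat_tail (eps V : R) : 0 < eps -> 0 < B -> 0 < V ->
  linstat_var mu n f <= V ->
  (OPE mu n [set l | (eps <= `|linstat f l - mean_linstat mu n f|)%R]
   <= (2 * expR (- (eps * Num.min (eps / (12 * V)) (6 * B)^-1)))%:E)%E.
Proof.
move=> e0 B0 V0 vV.
(* The first value minimizes [- t * eps + 3 * t^2 * V], the second is the largest one allowed. As
   [6 * V * t <= eps], the quadratic term costs at most half of [t * eps], and [t / 2] is the
   minimum in the statement. *)
pose t := Num.min (eps / (6 * V)) (3 * B)^-1.
have t0 : 0 <= t by rewrite le_min !divr_ge0 ?invr_ge0 ?mulr_ge0// ltW.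
have tB : t * B <= 3^-1.
  rewrite -ler_pdivlMr// ge_min; apply/orP; right.
  by rewrite invfM mulrC.
apply: (le_trans (OPE_linstat_concentration _ t0 tB)).
rewrite lee_fin ler_wpM2l// ler_expR.
have tV : 6 * V * t <= eps.
  rewrite mulrC -ler_pdivlMr ?mulr_gt0// ge_min lexx//.
have mE : Num.min (eps / (12 * V)) (6 * B)^-1 = t / 2.
  rewrite /t minr_pMl ?invr_ge0//; congr Num.min.
    by rewrite -mulrA -invfM mulrAC -natrM.
  by rewrite -invfM mulrAC -natrM.
rewrite mE.
have : t ^+ 2 * linstat_var mu n f <= t ^+ 2 * V by rewrite ler_wpM2l ?sqr_ge0.
have : t * (6 * V * t) <= t * eps by rewrite ler_wpM2l.
lra.
Qed.

End concentration.

(** * Variance *)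

Section variance.
Context (R : realType) (mu : probability R R).
Hypothesis adm : admissible mu.

Local Notation p := (orthopoly mu).

Section fixed_size.
Variable n : nat.
Local Notation phi := (@orthofun R mu n).
Local Notation G := (gram mu phi).

(** Dropping the subtracted squares leaves the trace of G(f^2), whose [n] diagonal entries are
    averages of [f^2] for the probability densities [p_a^2]. *)
Lemma linstat_var_le (f : R -> R) (B : R) : measurable_fun setT f -> (forall x, `|f x| <= B) ->
  linstat_var mu n f <= n%:R * B ^+ 2.
Proof.
move=> mf fB.
have B0 : 0 <= B := le_trans (normr_ge0 _) (fB 0).
have bf2 := bounded_measurable_sqr mf fB.
apply: (@le_trans _ _ (\tr (G (fun x => f x ^+ 2)))).
  rewrite gerBl; apply: sumr_ge0 => a _; apply: sumr_ge0 => b _; exact: sqr_ge0.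
rewrite mulr_natl -[in leRHS](card_ord n) -sumr_const; apply: ler_sum => a _.
have int1 : Rintegrable mu (fun x => 1 * (phi a x * phi a x)).
  exact: (Rintegrable_gram adm _ _ (bounded_measurable_cst 1)).
have -> : B ^+ 2 = \int[mu]_x (B ^+ 2 * (1 * (phi a x * phi a x))).
  rewrite (RintegralZl _ _ int1)//.
  by have := gram1 adm n => /matrixP /(_ a a); rewrite !mxE eqxx => ->; rewrite mulr1.
rewrite mxE; apply: le_Rintegral => //.
- exact: (Rintegrable_gram adm _ _ bf2).
- exact: (RintegrableZl _ int1).
- move=> x _; rewrite mul1r ler_wpM2r -?expr2 ?sqr_ge0//.
  by rewrite -[f x ^+ 2]ger0_norm ?sqr_ge0// normrX ler_sqr ?nnegrE//.
Qed.

(** Weak enough to admit the identity function, which is not bounded. *)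
Definition gram_integrable (h : R -> R) :=
  (forall a b, Rintegrable mu (fun x => h x * (phi a x * phi b x))) /\
  (forall a b, Rintegrable mu (fun x => h x ^+ 2 * (phi a x * phi b x))).

(** The inner integral of the double integral for the variance. Being a finite sum of products, it
    is computed explicitly, and Fubini's theorem is avoided. *)
Definition sqdiff (h : R -> R) (y : R) : R :=
  \int[mu]_x ((h x - h y) ^+ 2 * CD_kernel mu n x y ^+ 2).

Lemma CD_kernel_sqr x y :
  CD_kernel mu n x y ^+ 2 = \sum_a \sum_b (phi a x * phi b x) * (phi a y * phi b y).
Proof.
rewrite /CD_kernel expr2 big_distrlr/=; apply: eq_bigr => a _; apply: eq_bigr => b _.
exact: mulrACA.
Qed.

Let Rintegrable_phi a b : Rintegrable mu (fun x => phi a x * phi b x).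
Proof. exact: (Rintegrable_polyM adm.1). Qed.

Let Rintegral_phi a b : \int[mu]_x (phi a x * phi b x) = (a == b)%:R.
Proof. exact: (ip_orthopoly adm). Qed.

Lemma Rintegral_sum2 (F : 'I_n -> 'I_n -> R -> R) :
  (forall a b, Rintegrable mu (F a b)) ->
  Rintegrable mu (fun x => \sum_a \sum_b F a b x) /\
  \int[mu]_x (\sum_a \sum_b F a b x) = \sum_a \sum_b \int[mu]_x F a b x.
Proof.
move=> intF.
have intF2 a : Rintegrable mu (fun x => \sum_b F a b x).
  exact: Rintegrable_sum.
split; first exact: Rintegrable_sum.
rewrite Rintegral_sum//; apply: eq_bigr => a _.
by rewrite Rintegral_sum.
Qed.

(** The reproducing property of the kernel on the diagonal; integrating once more in [y] gives total
    mass [n]. *)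
Lemma Rintegral_CD_kernel_sqr y :
  Rintegrable mu (fun x => CD_kernel mu n x y ^+ 2) /\
  \int[mu]_x (CD_kernel mu n x y ^+ 2) = \sum_a phi a y * phi a y.
Proof.
under eq_fun do rewrite CD_kernel_sqr; under eq_Rintegral do rewrite CD_kernel_sqr.
have intF a b : Rintegrable mu (fun x => phi a x * phi b x * (phi a y * phi b y)).
  under eq_fun do rewrite mulrC; exact: RintegrableZl.
have [H1 H2] := Rintegral_sum2 intF; split=> //; rewrite H2.
apply: eq_bigr => a _; rewrite (bigD1 a)//= [X in _ + X]big1 ?addr0.
  by rewrite (RintegralZr _ _ (Rintegrable_phi a a))//= Rintegral_phi eqxx mul1r.
by move=> b ba; rewrite (RintegralZr _ _ (Rintegrable_phi a b))//=
    Rintegral_phi eq_sym (negPf ba) mul0r.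
Qed.

Lemma sqdiffE h y : gram_integrable h ->
  Rintegrable mu (fun x => (h x - h y) ^+ 2 * CD_kernel mu n x y ^+ 2) /\
  sqdiff h y = \sum_a \sum_b
    (G (fun x => h x ^+ 2) a b * (phi a y * phi b y) +
     (- 2 * G h a b * (h y * (phi a y * phi b y)) +
      (a == b)%:R * (h y ^+ 2 * (phi a y * phi b y)))).
Proof.
move=> [inth inth2].
pose F a b x := (phi a y * phi b y) * (h x ^+ 2 * (phi a x * phi b x)) +
    ((- 2 * h y * (phi a y * phi b y)) * (h x * (phi a x * phi b x)) +
     (h y ^+ 2 * (phi a y * phi b y)) * (phi a x * phi b x)).
have E x : (h x - h y) ^+ 2 * CD_kernel mu n x y ^+ 2 = \sum_a \sum_b F a b x.
  rewrite CD_kernel_sqr mulr_sumr; apply: eq_bigr => a _; rewrite mulr_sumr.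
  by apply: eq_bigr => b _; rewrite /F; ring.
have i1 a b c := RintegrableZl c (inth2 a b).
have i2 a b c := RintegrableZl c (inth a b).
have i3 a b c := RintegrableZl c (Rintegrable_phi a b).
have intF a b : Rintegrable mu (F a b).
  exact: (RintegrableD (i1 a b _) (RintegrableD (i2 a b _) (i3 a b _))).
rewrite /sqdiff.
under eq_fun do rewrite E; under eq_Rintegral do rewrite E.
have [H1 H2] := Rintegral_sum2 intF; split=> //; rewrite H2.
apply: eq_bigr => a _; apply: eq_bigr => b _.
rewrite /F RintegralD//; [|exact: i1|exact: (RintegrableD (i2 a b _) (i3 a b _))].
rewrite RintegralD//; [|exact: i2|exact: i3].
rewrite (RintegralZl _ _ (inth2 a b))// (RintegralZl _ _ (inth a b))//.
rewrite (RintegralZl _ _ (Rintegrable_phi a b))// Rintegral_phi !mxE.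
by ring.
Qed.

Lemma Rintegral_sqdiff h : gram_integrable h ->
  Rintegrable mu (sqdiff h) /\ \int[mu]_y sqdiff h y = 2 * linstat_var mu n h.
Proof.
move=> inth; have [inth1 inth2] := inth.
have E : sqdiff h = fun y => \sum_a \sum_b
    (G (fun x => h x ^+ 2) a b * (phi a y * phi b y) +
     (- 2 * G h a b * (h y * (phi a y * phi b y)) +
      (a == b)%:R * (h y ^+ 2 * (phi a y * phi b y)))).
  by apply/funext => y; exact: (sqdiffE y inth).2.
rewrite E.
have i1 a b c := RintegrableZl c (inth2 a b).
have i2 a b c := RintegrableZl c (inth1 a b).
have i3 a b c := RintegrableZl c (Rintegrable_phi a b).
have [|H1 H2] := @Rintegral_sum2 (fun a b y => G (fun x => h x ^+ 2) a b * (phi a y * phi b y) +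
     (- 2 * G h a b * (h y * (phi a y * phi b y)) +
      (a == b)%:R * (h y ^+ 2 * (phi a y * phi b y)))).
  by move=> a b; exact: (RintegrableD (i3 a b _) (RintegrableD (i2 a b _) (i1 a b _))).
split; first exact: H1.
rewrite H2.
transitivity (\sum_a \sum_b ((a == b)%:R * (2 * G (fun x => h x ^+ 2) a b) - 2 * G h a b ^+ 2)).
  apply: eq_bigr => a _; apply: eq_bigr => b _.
  rewrite RintegralD//; [|exact: i3|exact: (RintegrableD (i2 a b _) (i1 a b _))].
  rewrite RintegralD//; [|exact: i2|exact: i1].
  rewrite (RintegralZl _ _ (inth2 a b))// (RintegralZl _ _ (inth1 a b))//.
  rewrite (RintegralZl _ _ (Rintegrable_phi a b))// Rintegral_phi.
  have -> : \int[mu]_y (h y * (phi a y * phi b y)) = G h a b by rewrite mxE.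
  have -> : \int[mu]_y (h y ^+ 2 * (phi a y * phi b y)) = G (fun x => h x ^+ 2) a b by rewrite mxE.
  by ring.
rewrite mulrBr /mxtrace !mulr_sumr -sumrB; apply: eq_bigr => a _.
rewrite sumrB mulr_sumr; congr (_ - _).
rewrite (bigD1 a)//= eqxx mul1r [X in _ + X]big1 ?addr0// => b ba.
by rewrite eq_sym (negPf ba) mul0r.
Qed.

(** The pointwise inequality is integrated against K_n^2, which has total mass [n]. Twice the
    variance appears on the left, so the term in [delta] could be halved. *)
Lemma linstat_var_compare f g (delta M : R) :
  gram_integrable f -> gram_integrable g -> 0 <= delta -> 0 <= M ->
  (forall x y, (f x - f y) ^+ 2 <= delta + M * (g x - g y) ^+ 2) ->
  linstat_var mu n f <= n%:R * delta + M * linstat_var mu n g.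
Proof.
move=> intf intg d0 M0 fg.
have [If Ef] := Rintegral_sqdiff intf; have [Ig Eg] := Rintegral_sqdiff intg.
have IK : Rintegrable mu (fun y => \sum_a phi a y * phi a y).
  by apply: Rintegrable_sum => a _.
have EK : \int[mu]_y (\sum_a phi a y * phi a y) = n%:R.
  rewrite Rintegral_sum//; under eq_bigr do rewrite Rintegral_phi eqxx.
  by rewrite sumr_const card_ord.
suff : 2 * linstat_var mu n f <= n%:R * delta + M * (2 * linstat_var mu n g).
  have : 0 <= n%:R * delta by rewrite mulr_ge0.
  by lra.
rewrite -Ef -Eg -EK [X in X + _]mulrC.
rewrite -(RintegralZl _ _ IK)// -(RintegralZl _ _ Ig)// -RintegralD//; last 2 first.
- exact: RintegrableZl.
- exact: RintegrableZl.
apply: le_Rintegral => //.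
  exact: (RintegrableD (RintegrableZl _ IK) (RintegrableZl _ Ig)).
move=> y _; have [JK FK] := Rintegral_CD_kernel_sqr y.
rewrite -FK /sqdiff -(RintegralZl _ _ JK)//.
rewrite -(RintegralZl _ _ (sqdiffE y intg).1)// -RintegralD//; last 2 first.
- exact: RintegrableZl.
- exact: (RintegrableZl _ (sqdiffE y intg).1).
apply: le_Rintegral => //.
- exact: (sqdiffE y intf).1.
- exact: (RintegrableD (RintegrableZl _ JK) (RintegrableZl _ (sqdiffE y intg).1)).
by move=> x _; rewrite mulrA -mulrDl ler_wpM2r// sqr_ge0.
Qed.

End fixed_size.
End variance.

(** * The variance of the identity function as a recurrence coefficient *)

Section recurrence_coefficient.
Context (R : realType) (mu : probability R R).
Hypothesis adm : admissible mu.

Local Notation p := (orthopoly mu).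

Lemma orthopoly_expansion m (q : {poly R}) : (size q <= m)%N ->
  q = \sum_(i < m) ip mu q (p i) *: p i.
Proof.
elim: m q => [|m IH] q sq.
  by rewrite big_ord0; apply/eqP; rewrite -size_poly_leq0.
pose c := q`_m / gamma mu m.
have [r rE] : exists r, r = q - c *: p m by exists (q - c *: p m).
have qE : q = r + c *: p m by rewrite rE subrK.
have sr : (size r <= m)%N.
  apply/leq_sizeP => j; rewrite leq_eqVlt => /predU1P[<-|mj].
    rewrite rE coefB coefZ /c /gamma lead_coefE (size_orthopoly adm)/=.
    have := gamma_gt0 adm m; rewrite /gamma lead_coefE (size_orthopoly adm)/= => g0.
    by rewrite divfK ?subrr// gt_eqF.
  rewrite rE coefB coefZ [q`_j]nth_default ?[(p m)`_j]nth_default ?mulr0 ?subr0//.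
    by rewrite (size_orthopoly adm).
  exact: leq_trans sq mj.
(* By induction [r] is a combination of the [p i] with [i < m]; hence the coefficient [c] that
   cancels the top degree of [q] is also its Fourier coefficient. *)
have rm : ip mu r (p m) = 0.
  rewrite (IH _ sr) (ip_suml adm.1) big1// => i _.
  by rewrite (ipZl adm.1) (ip_orthopoly adm) (ltn_eqF (ltn_ord i)) mulr0.
have qm : ip mu q (p m) = c.
  by rewrite qE (ipDl adm.1) rm add0r (ipZl adm.1) (ip_orthopoly adm) eqxx mulr1.
rewrite big_ord_recr/= qm {1}qE; congr (_ + _).
rewrite {1}(IH _ sr); apply: eq_bigr => i _; congr (_ *: _).
rewrite qE (ipDl adm.1) (ipZl adm.1) (ip_orthopoly adm).
by rewrite eq_sym (ltn_eqF (ltn_ord i)) mulr0 addr0.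
Qed.

Lemma parseval m (q : {poly R}) : (size q <= m)%N ->
  ip mu q q = \sum_(i < m) ip mu q (p i) ^+ 2.
Proof.
move=> sq; rewrite {1}(orthopoly_expansion sq) (ip_suml adm.1).
by apply: eq_bigr => i _; rewrite (ipZl adm.1) ipC expr2.
Qed.

Lemma ip_top_coef n (q : {poly R}) : (size q <= n.+1)%N ->
  ip mu q (p n) = q`_n / gamma mu n.
Proof.
move=> sq; have /(congr1 (fun r : {poly R} => r`_n)) := orthopoly_expansion sq.
rewrite coef_sum big_ord_recr/= big1 ?add0r => [->|i _].
  rewrite coefZ /gamma lead_coefE (size_orthopoly adm) mulfK//.
  have := gamma_gt0 adm n; rewrite /gamma lead_coefE (size_orthopoly adm)/=.
  by move/lt0r_neq0.
by rewrite coefZ nth_default ?mulr0// (size_orthopoly adm).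
Qed.

Lemma gram_integrable_id n : gram_integrable mu n id.
Proof.
split=> a b.
  have := Rintegrable_poly adm.1 ('X * (p a * p b)).
  by under eq_fun do rewrite hornerM hornerX hornerM.
have := Rintegrable_poly adm.1 ('X ^+ 2 * (p a * p b)).
by under eq_fun do rewrite hornerM hornerXn hornerM.
Qed.

(** Expanded in p_0, ..., p_n, each x p_a with a < n has by Parseval only its p_n component left
    after the subtraction. That component is nonzero for a = n - 1 only, by degree. *)
Lemma linstat_var_id n : (0 < n)%N ->
  linstat_var mu n id = (gamma mu n.-1 / gamma mu n) ^+ 2.
Proof.
case: n => // m _; set n := m.+1.
have sX (a : 'I_n) : (size ('X * p a)%R <= n.+1)%N.
  by rewrite mulrC size_mulX -?size_poly_eq0 (size_orthopoly adm)// ltnS.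
have trE : \tr (gram mu (@orthofun R mu n) (fun x => x ^+ 2)) =
    \sum_(a < n) ip mu ('X * p a) ('X * p a).
  apply: eq_bigr => a _; rewrite mxE; apply: eq_Rintegral => x _.
  by rewrite hornerM hornerX /orthofun; ring.
have gE (a b : 'I_n) : gram mu (@orthofun R mu n) id a b = ip mu ('X * p a) (p b).
  by rewrite mxE; apply: eq_Rintegral => x _; rewrite hornerM hornerX /orthofun mulrA.
rewrite /linstat_var trE -sumrB.
transitivity (\sum_(a < n) (('X * p a)`_n / gamma mu n) ^+ 2).
  apply: eq_bigr => a _; rewrite (parseval (sX a)) big_ord_recr/=.
  rewrite (ip_top_coef (sX a)) addrC -[RHS]addr0 -addrA; congr (_ + _).
  by apply/eqP; rewrite subr_eq0; apply/eqP; apply: eq_bigr => b _; rewrite gE.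
rewrite (bigD1 (ord_max : 'I_n))//= [X in _ + X]big1 ?addr0.
  by rewrite coefXM/= /gamma [in RHS]lead_coefE (size_orthopoly adm).
move=> a am; rewrite coefXM/= nth_default ?mul0r ?expr0n//.
rewrite (size_orthopoly adm) ltn_neqAle -ltnS ltn_ord andbT.
by rewrite -val_eqE/= in am.
Qed.

End recurrence_coefficient.

(** * Measures with compact support *)

Section compact_support.
Context (R : realType) (mu : probability R R).

(** Every point outside the support lies in a null interval with rational endpoints, and there are
    countably many of these. *)
Lemma mu_compl_itv0 (M : R) : msupport mu `<=` `[- M, M] ->
  mu (~` `[- M, M]) = 0%E.
Proof.
move=> sM.
pose I (ab : rat * rat) : set R := `]ratr ab.1, ratr ab.2[%classic.
(* Enumerates the null rational intervals by their codes; all other codes give the empty set. *)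
pose Fn k : set R := if @unpickle (rat * rat)%type k is Some ab then
  (if mu (I ab) == 0%E then I ab else set0) else set0.
have mF k : measurable (Fn k).
  rewrite /Fn; case: unpickle => [ab|]//; case: ifP => // _.
  exact: measurable_itv.
have F0 k : mu (Fn k) = 0%E.
  rewrite /Fn; case: unpickle => [ab|]; last exact: measure0.
  by case: eqP => // _; exact: measure0.
have mB : measurable (~` `[- M, M] : set R).
  by apply: measurableC; exact: measurable_itv.
apply/(negligibleP mu mB).
have : mu.-negligible (\bigcup_k Fn k).
  by apply: negligible_bigcup => k; apply/(negligibleP mu (mF k)); exact: F0.
apply: negligibleS.
move=> x xM.
have /existsNP[U /not_implyP[oU /not_implyP[Ux /negP]]] : ~ msupport mu x.
  by move=> /sM.
rewrite -leNgt => U0.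
have {}U0 : mu U = 0%E by apply/eqP; rewrite eq_le U0 measure_ge0.
have /nbhs_ballP[e /= e0 eU] : nbhs x U by exact: open_nbhs_nbhs.
have [a /andP[xa ax]] : exists a : rat, x - e < ratr a < x.
  by have [|a] := @rat_in_itvoo R (x - e) x; [lra|rewrite in_itv/=; exists a].
have [b /andP[xb bx]] : exists b : rat, x < ratr b < x + e.
  by have [|b] := @rat_in_itvoo R x (x + e); [lra|rewrite in_itv/=; exists b].
have IU : I (a, b) `<=` U.
  move=> y; rewrite /I /= in_itv/= => /andP[ay yb]; apply: eU.
  by rewrite /ball/= ltr_norml; apply/andP; split; lra.
have I0 : mu (I (a, b)) = 0%E.
  apply/eqP; rewrite eq_le measure_ge0 andbT -U0 le_measure//.
  - by apply/mem_set; exact: measurable_itv.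
  - by apply/mem_set; exact: open_measurable.
have FE : Fn (pickle (a, b)) = I (a, b) by rewrite /Fn pickleK I0 eqxx.
by exists (pickle (a, b)); [exact: Logic.I|rewrite FE /I/= in_itv/= ax xb].
Qed.

Lemma eq_Rintegral_support (M : R) (f g : R -> R) :
  mu (~` `[- M, M]) = 0%E -> measurable_fun setT f -> measurable_fun setT g ->
  (forall x, `|x| <= M -> f x = g x) -> \int[mu]_x f x = \int[mu]_x g x.
Proof.
move=> mu0 mf mg fg; congr fine; apply: ae_eq_integral => //.
- exact/measurable_EFinP.
- exact/measurable_EFinP.
- have mB : measurable (~` `[- M, M] : set R).
    by apply: measurableC; exact: measurable_itv.
  apply: negligibleS ((negligibleP mu mB).2 mu0).
  move=> x /= H; rewrite in_itv/= => xM; apply: H => _.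
  by rewrite fg// ler_norml.
Qed.

(** The projection onto [-M, M]. Composing with it makes a continuous function uniformly continuous
    on the whole line and changes nothing on the support. *)
Definition clamp (M x : R) := Num.max (- M) (Num.min x M).

Section clamp.
Variable M : R.
Hypothesis M0 : 0 <= M.

Lemma clamp_id x : `|x| <= M -> clamp M x = x.
Proof.
rewrite ler_norml /clamp => /andP[Mx xM].
by rewrite (min_idPl xM) (max_idPr Mx).
Qed.

Lemma norm_clamp_le x : `|clamp M x| <= M.
Proof.
rewrite ler_norml /clamp le_max lexx/= ge_max ge_min lexx orbT andbT.
by rewrite (le_trans _ M0)// oppr_le0.
Qed.

Lemma clamp_lipschitz x y : `|clamp M x - clamp M y| <= `|x - y|.
Proof.
have H a b : a <= b -> 0 <= clamp M b - clamp M a <= b - a.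
  move=> ab; rewrite subr_ge0 lerBlDl; apply/andP; split.
    rewrite {1}/clamp ge_max /clamp !le_max lexx/=; apply/orP; right.
    by rewrite le_min !ge_min ab lexx orbT.
  rewrite {1}/clamp ge_max; apply/andP; split.
    have : - M <= clamp M a by rewrite /clamp le_max lexx.
    lra.
  have h1 : Num.min a M <= clamp M a by rewrite /clamp le_max lexx orbT.
  have h2 : Num.min b M <= b by rewrite ge_min lexx.
  have h3 : Num.min b M <= M by rewrite ge_min lexx orbT.
  have h4 : Num.min b M - (b - a) <= Num.min a M by rewrite le_min; apply/andP; split; lra.
  lra.
have [xy|/ltW yx] := leP x y.
  have /andP[h0 h1] := H _ _ xy.
  by rewrite distrC (ger0_norm h0) (distrC x) ger0_norm// subr_ge0.
have /andP[h0 h1] := H _ _ yx.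
by rewrite (ger0_norm h0) ger0_norm// subr_ge0.
Qed.

Lemma measurable_clamp : measurable_fun setT (clamp M).
Proof. by apply: measurable_maxr => //; exact: measurable_minr. Qed.

End clamp.

Section support_in_interval.
Variables (M : R).
Hypotheses (adm : admissible mu) (M0 : 0 <= M) (mu0 : mu (~` `[- M, M]) = 0%E).

Local Notation p := (orthopoly mu).

Lemma linstat_var_clamp n (f : R -> R) : measurable_fun setT f ->
  linstat_var mu n f = linstat_var mu n (f \o clamp M).
Proof.
move=> mf.
have mc := measurable_clamp.
have mp (a : 'I_n) : measurable_fun setT (orthofun mu a) by exact: measurable_horner.
have gE (h h' : R -> R) : measurable_fun setT h -> measurable_fun setT h' ->
    (forall x, `|x| <= M -> h x = h' x) ->
    gram mu (@orthofun R mu n) h = gram mu (@orthofun R mu n) h'.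
  move=> mh mh' hh'; apply/matrixP => a b; rewrite !mxE.
  apply: (eq_Rintegral_support mu0).
  - by apply: measurable_funM => //; exact: measurable_funM.
  - by apply: measurable_funM => //; exact: measurable_funM.
  - by move=> x xM; rewrite hh'.
have mfc : measurable_fun setT (f \o clamp M) by exact: measurableT_comp.
rewrite /linstat_var (gE f (f \o clamp M))//; last first.
  by move=> x xM /=; rewrite clamp_id.
rewrite (gE (fun x => f x ^+ 2) (fun x => (f \o clamp M) x ^+ 2))//.
- exact: measurable_funX.
- exact: measurable_funX.
- by move=> x xM /=; rewrite clamp_id.
Qed.

(** The ratio is the integral of x p_{n-1} p_n, where |x| <= M almost everywhere and |p_{n-1} p_n|
    is at most the mean of two squares of integral 1. *)
Lemma gamma_ratio_le n : (0 < n)%N -> (gamma mu n.-1 / gamma mu n) ^+ 2 <= M ^+ 2.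
Proof.
case: n => // m _; set n := m.+1.
have sX : (size ('X * p m)%R <= n.+1)%N.
  by rewrite mulrC size_mulX -?size_poly_eq0 (size_orthopoly adm).
have aE : gamma mu m / gamma mu n = ip mu ('X * p m) (p n).
  by rewrite (ip_top_coef adm sX) coefXM/= {1}/gamma lead_coefE (size_orthopoly adm).
have int j : Rintegrable mu (fun x => (p j).[x] * (p j).[x]).
  exact: (Rintegrable_polyM adm.1).
have intj := RintegrableD (int m) (int n).
have intX : Rintegrable mu (fun x => ('X * p m).[x] * (p n).[x]).
  exact: (Rintegrable_polyM adm.1).
have mc := measurable_clamp M.
have mp j : measurable_fun setT (horner (p j)) by exact: measurable_horner.
have mcp : measurable_fun setT (fun x => clamp M x * ((p m).[x] * (p n).[x])).
  by apply: measurable_funM => //; exact: measurable_funM.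
have AMGM (x y : R) : `|x * y| <= 2^-1 * (x * x + y * y).
  rewrite ler_norml; apply/andP; split.
    have := sqr_ge0 (x + y); rewrite sqrrD !expr2; lra.
  have := sqr_ge0 (x - y); rewrite sqrrB !expr2; lra.
have bnd x : `|clamp M x * ((p m).[x] * (p n).[x])| <=
    M * 2^-1 * ((p m).[x] * (p m).[x] + (p n).[x] * (p n).[x]).
  rewrite normrM -mulrA; apply: ler_pM => //; first exact: norm_clamp_le.
have intc : Rintegrable mu (fun x => clamp M x * ((p m).[x] * (p n).[x])).
  apply: (le_Rintegrable mcp (RintegrableZl (M * 2^-1) intj)) => x.
  by rewrite (le_trans (bnd x))// ler_norm.
suff : `|gamma mu m / gamma mu n| <= M.
  by move=> H; rewrite -[leLHS]ger0_norm ?sqr_ge0// normrX ler_sqr ?nnegrE.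
have E : \int[mu]_x (('X * p m).[x] * (p n).[x]) =
    \int[mu]_x (clamp M x * ((p m).[x] * (p n).[x])).
  apply: (eq_Rintegral_support mu0 _ mcp).
    exact: Rintegrable_measurable intX.
  by move=> x xM; rewrite clamp_id// hornerM hornerX mulrA.
rewrite aE /ip E.
apply: (le_trans (le_normr_Rintegral _ intc)) => //.
apply: (@le_trans _ _ (\int[mu]_x (M * 2^-1 * ((p m).[x] * (p m).[x] + (p n).[x] * (p n).[x])))).
  apply: le_Rintegral => //; first exact: (integrable_norm intc).
  exact: (RintegrableZl _ intj).
rewrite (RintegralZl _ _ intj)// (RintegralD _ (int m) (int n))//.
have e j : \int[mu]_x ((p j).[x] * (p j).[x]) = 1.
  by have := ip_orthopoly adm j j; rewrite eqxx.
rewrite !e; lra.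
Qed.

End support_in_interval.

(** Heine's theorem on [-M, M], from the covering form of compactness with half radii; it extends to
    the line because [clamp M] is 1-Lipschitz. *)
Lemma heine_clamp (M : R) (f : R -> R) : 0 <= M -> continuous f ->
  forall eta, 0 < eta -> exists2 delta, 0 < delta &
    forall x y, `|x - y| < delta -> `|f (clamp M x) - f (clamp M y)| < eta.
Proof.
move=> M0 cf eta eta0.
have cK : compact `[- M, M] by exact: segment_compact.
have cov := (compact_near_coveringP _).1 cK.
pose P (delta x : R) := forall y, `|x - y| < delta -> `|f x - f y| < eta.
have H : \forall delta \near 0^'+, `[- M, M] `<=` P delta.
  apply: cov => x _.
  have eta2 : 0 < eta / 2 by rewrite divr_gt0.
  have /cvgrPdist_lt /(_ _ eta2) /nbhs_ballP[r /= r0 rf] := cf x.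
  have rf' y : `|x - y| < r -> `|f x - f y| < eta / 2 by move=> ?; exact: rf.
  exists (ball x (r / 2), [set d | d < r / 2]) => /=.
    split; first by apply: nbhsx_ballx; rewrite divr_gt0.
    by apply: nbhs_right_lt; rewrite divr_gt0.
  move=> [x' d] /= [xx' dr] y x'y.
  rewrite /ball/= in xx'.
  have h1 : `|f x - f x'| < eta / 2 by apply: rf'; lra.
  have h2 : `|f x - f y| < eta / 2.
    apply: rf'; rewrite -(subrK x' x) -addrA (le_lt_trans (ler_normD _ _))//; lra.
  rewrite -(subrK (f x) (f x')) -addrA (le_lt_trans (ler_normD _ _))//.
  by rewrite distrC; lra.
have [d [d0 dP]] : exists d, 0 < d /\ `[- M, M] `<=` P d.
  near (0 : R)^'+ => d.
  exists d; split; first by near: d; exact: nbhs_right_gt.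
  by near: d; exact: H.
exists d => // x y xy; apply: dP.
  by rewrite /= in_itv/= -ler_norml norm_clamp_le.
by apply: (le_lt_trans _ xy); exact: clamp_lipschitz.
Unshelve. all: end_near. Qed.

End compact_support.

(** * Tail bounds *)

Section norms.
Context (R : realType).
Implicit Types f : R -> R.

Lemma le_supnorm f x : (`|f x|%:E <= supnorm f)%E.
Proof. by apply: ereal_sup_ubound; exists x. Qed.

(** The cases of the tail bounds: an infinite norm makes the bound trivial, a zero norm makes the
    statistic constant, and otherwise the extended reals reduce to real numbers. *)
Lemma supnorm_cases f : [\/ supnorm f = +oo%E, (forall x, f x = 0) |
  exists2 B, 0 < B & supnorm f = B%:E /\ forall x, `|f x| <= B].
Proof.
have sf := le_supnorm f.
case E : (supnorm f) => [B| |].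
- have fB x : `|f x| <= B by have := sf x; rewrite E lee_fin.
  have [B0|B0] := leP B 0; [apply: Or32|apply: Or33].
    move=> x; apply/eqP; rewrite -normr_eq0 eq_le normr_ge0 andbT.
    exact: le_trans (fB x) B0.
  by exists B.
- exact: Or31.
- by have := sf 0; rewrite E.
Qed.

Lemma supnorm_lty f : bounded_fun f -> (supnorm f < +oo)%E.
Proof.
move=> [M [Mr MB]]; apply: (@le_lt_trans _ _ (M + 1)%:E); last exact: ltry.
apply: ge_ereal_sup => _ [x _ <-]; rewrite lee_fin.
by apply: MB => //; rewrite ltrDl.
Qed.

Lemma le_lipnorm f L : lipnorm f = L%:E -> forall x y, `|f x - f y| <= L * `|x - y|.
Proof.
move=> fL x y; have [->|xy] := eqVneq x y; first by rewrite !subrr normr0 mulr0.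
have : ((`|f x - f y| / `|x - y|)%:E <= lipnorm f)%E.
  by apply: ereal_sup_ubound; exists (x, y).
by rewrite fL lee_fin ler_pdivrMr// normr_gt0 subr_eq0.
Qed.

Lemma lipschitz_lipnorm f : lipschitz f -> exists2 L, 0 <= L & lipnorm f = L%:E.
Proof.
move=> [M [Mr MB]].
have ub : (lipnorm f <= (M + 1)%:E)%E.
  apply: ge_ereal_sup => _ [[x y] /= xy <-]; rewrite lee_fin.
  rewrite ler_pdivrMr ?normr_gt0 ?subr_eq0//.
  by apply: (MB (M + 1) _ (x, y)) => //; rewrite ltrDl.
have lb : (0 <= lipnorm f)%E.
  apply: (@le_trans _ _ (`|f 1 - f 0| / `|1 - 0|)%:E).
    by rewrite lee_fin divr_ge0.
  by apply: ereal_sup_ubound; exists (1, 0) => //=; exact: oner_neq0.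
have fn : lipnorm f \is a fin_num by rewrite ge0_fin_numE// (le_lt_trans ub)// ltry.
by exists (fine (lipnorm f)); [exact: fine_ge0|rewrite fineK].
Qed.

End norms.

Section tail_bounds.
Context (R : realType).
Implicit Types (mu : probability R R) (f : R -> R).

Lemma OPE_linstat_null mu n f eps : admissible mu -> (forall x, f x = 0) -> 0 < eps ->
  OPE mu n [set l | (eps <= `|linstat f l - mean_linstat mu n f|)%R] = 0%E.
Proof.
move=> adm f0 e0; rewrite (_ : [set _ | _] = set0) ?measure0//.
have -> : f = fun=> 0 by apply/funext.
have l0 : @linstat R (fun=> 0) n = cst 0.
  by apply/funext => l; rewrite /linstat big1.
have m0 : mean_linstat mu n (fun=> 0) = 0.
  by rewrite /mean_linstat l0 expectation_cst.
by apply/seteqP; split => l //=; rewrite m0 l0 /= subr0 normr0 leNgt e0.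
Qed.

Lemma scaled_eventE mu n f eps : (0 < n)%N ->
  [set l : n.-tuple R | (eps <= `|linstat f l / n%:R - mean_linstat mu n f / n%:R|)%R] =
  [set l | (n%:R * eps <= `|linstat f l - mean_linstat mu n f|)%R].
Proof.
move=> n0; have nR : (0 : R) < n%:R by rewrite ltr0n.
apply/funext => l /=; rewrite -mulrBl normrM normfV [`|n%:R|]gtr0_norm//.
by rewrite ler_pdivlMr// mulrC.
Qed.

Lemma OPE_le2 mu n (S : set (n.-tuple R)) (x : \bar R) : measurable S -> (0 <= x)%E ->
  (OPE mu n S <= 2%:E * expeR x)%E.
Proof.
move=> mS x0; apply: (le_trans (probability_le1 _ mS)).
apply: (@le_trans _ _ (2%:E * 1)%E); first by rewrite mule1 lee_fin ler1n.
by apply: lee_wpmul2l; rewrite ?lee_fin// -expeR0 lee_expeR.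
Qed.

Lemma inver_gt0 (r : R) : 0 < r -> (r%:E^-1 = (r^-1)%:E)%E.
Proof. by move=> r0; rewrite inver gt_eqF. Qed.

Lemma expeR_minE (x e c B : R) : 0 < c -> 0 < B ->
  (2%:E * expeR (- (x%:E * mine (e%:E / c%:E) (6%:E * B%:E)^-1)) =
   (2 * expR (- (x * Num.min (e / c) (6 * B)^-1)))%:E)%E.
Proof.
move=> c0 B0.
by rewrite -EFinM !inver_gt0 ?mulr_gt0// -EFinM -EFin_min -!EFinM.
Qed.

Lemma expeR_divE (x B : R) : 0 < B ->
  (2%:E * expeR (- (x%:E / (6%:E * B%:E))) = (2 * expR (- (x * (6 * B)^-1)))%:E)%E.
Proof.
by move=> B0; rewrite -EFinM inver_gt0 ?mulr_gt0// -!EFinM.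
Qed.

(** The variance bound is raised to [eps * B / 2], where the two terms of the minimum coincide. *)
Lemma OPE_linstat_tail_sup mu n f eps B V : admissible mu ->
  measurable_fun setT f -> (forall x, `|f x| <= B) -> 0 < B -> 0 < eps ->
  linstat_var mu n f <= V -> 2 * V <= eps * B ->
  (OPE mu n [set l | (eps <= `|linstat f l - mean_linstat mu n f|)%R]
   <= (2 * expR (- (eps * (6 * B)^-1)))%:E)%E.
Proof.
move=> adm mf fB B0 e0 vV V2.
have V0 : 0 < eps * B / 2 by rewrite divr_gt0 ?mulr_gt0.
have vV' : linstat_var mu n f <= eps * B / 2.
  by rewrite (le_trans vV)// ler_pdivlMr// mulrC.
have := OPE_linstat_tail adm mf fB e0 B0 V0 vV'.
have -> : eps / (12 * (eps * B / 2)) = (6 * B)^-1.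
  by field; rewrite !gt_eqF.
by rewrite minxx.
Qed.

Lemma bounded_concentration : exists A : R, 0 < A /\
  forall mu f (eps : R) (n : nat),
    admissible mu -> measurable_fun setT f -> bounded_fun f ->
    0 < eps -> (0 < n)%N ->
    (OPE mu n [set l | (eps <= `|linstat f l / n%:R
                                 - mean_linstat mu n f / n%:R|)%R]
     <= 2%:E * expeR (- ((n%:R * eps)%:E *
          mine (eps%:E / ((8 * A)%:E * supnorm f ^+ 2))
               (6%:E * supnorm f)^-1)))%E.
Proof.
(* With V = n B^2 and deviation n eps, the quotient is eps / (12 B^2), and 12 = 8 * (3 / 2). *)
exists (3 / 2); split=> [|mu f eps n adm mf bf e0 n0]; first by lra.
have nR : (0 : R) < n%:R by rewrite ltr0n.
have ne0 : 0 < n%:R * eps by rewrite mulr_gt0.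
rewrite scaled_eventE//.
have [fy|f0|[B B0 [fB leB]]] := supnorm_cases f.
- by have := supnorm_lty bf; rewrite fy.
- by rewrite OPE_linstat_null// mule_ge0 ?expeR_ge0// lee_fin.
rewrite fB -EFin_expe -EFinM expeR_minE//; last by rewrite mulr_gt0 ?exprn_gt0//; lra.
have V0 : 0 < n%:R * B ^+ 2 by rewrite mulr_gt0 ?exprn_gt0.
apply: (le_trans (OPE_linstat_tail adm mf leB ne0 B0 V0 (linstat_var_le adm n mf leB))).
rewrite lee_fin (_ : n%:R * eps / (12 * (n%:R * B ^+ 2)) = eps / (8 * (3 / 2) * B ^+ 2))//.
by field; rewrite !gt_eqF.
Qed.

(* The variance has to be [o(n)], but only if [f] is bounded: otherwise
   [supnorm f] is infinite and the bound is trivial. *)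
Lemma small_variance_concentration (mu : nat -> probability R R) f (eps : R) :
  (forall n, admissible (mu n)) -> measurable_fun setT f -> 0 < eps ->
  ((exists B, forall x, `|f x| <= B) ->
   forall c, 0 < c -> \forall n \near \oo, linstat_var (mu n) n f <= n%:R * c) ->
  \forall n \near \oo,
    (OPE (mu n) n [set l | (eps <= `|linstat f l / n%:R
                                     - mean_linstat (mu n) n f / n%:R|)%R]
     <= 2%:E * expeR (- ((n%:R * eps)%:E / (6%:E * supnorm f))))%E.
Proof.
move=> adm mf e0 var_small.
have [fy|f0|[B B0 [fB leB]]] := supnorm_cases f.
- near=> n; have n0 : (0 < n)%N by near: n; exact: nbhs_infty_gt.
  rewrite fy scaled_eventE//; apply: OPE_le2; first exact: measurable_linstat_dist_ge.
  by rewrite mulry gtr0_sg// mul1e invey mule0 oppe0.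
- near=> n; have n0 : (0 < n)%N by near: n; exact: nbhs_infty_gt.
  rewrite scaled_eventE// OPE_linstat_null//; last by rewrite mulr_gt0// ltr0n.
  by rewrite mule_ge0 ?expeR_ge0// lee_fin.
(* For the deviation n eps, a variance of at most n times this value meets the condition
   [2 * V <= eps * B] of [OPE_linstat_tail_sup]. *)
have c0 : 0 < eps * B / 2 by rewrite divr_gt0 ?mulr_gt0.
have bf : exists B, forall x, `|f x| <= B by exists B.
near=> n; have n0 : (0 < n)%N by near: n; exact: nbhs_infty_gt.
have nR : (0 : R) < n%:R by rewrite ltr0n.
rewrite scaled_eventE// fB expeR_divE//.
apply: (@OPE_linstat_tail_sup _ _ _ _ B (n%:R * (eps * B / 2))) => //.
- by rewrite mulr_gt0.
- by near: n; exact: var_small.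
- by rewrite le_eqVlt; apply/orP; left; apply/eqP; field.
Unshelve. all: end_near. Qed.

Lemma lipschitz_concentration (mu : nat -> probability R R) (C : R) :
  (forall n, admissible (mu n)) -> 0 < C ->
  (\forall n \near \oo, (gamma (mu n) n.-1 / gamma (mu n) n) ^+ 2 <= C) ->
  exists A : R, 0 < A /\
  forall (f : R -> R) (eps : R), lipschitz f -> 0 < eps ->
  \forall n \near \oo,
    (OPE (mu n) n [set l | (eps <= `|linstat f l
                                     - mean_linstat (mu n) n f|)%R]
     <= 2%:E * expeR (- (eps%:E *
          mine (eps%:E / ((4 * A)%:E * lipnorm f ^+ 2))
               (6%:E * supnorm f)^-1)))%E.
Proof.
(* The variance is at most L^2 C, and 12 L^2 C = 4 (3 C) L^2. *)
move=> adm C0 gC; exists (3 * C); split=> [|f eps lf e0]; first by lra.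
have [L L0 fL] := lipschitz_lipnorm lf.
have Lf := le_lipnorm fL.
have mf : measurable_fun setT f.
  apply: continuous_measurable_fun => x; apply/cvgrPdist_lt => e /= e_gt0.
  have L1 : 0 < L + 1 by lra.
  near=> y; rewrite (le_lt_trans (Lf x y))//.
  apply: (@le_lt_trans _ _ ((L + 1) * `|x - y|)); first by rewrite ler_wpM2r//; lra.
  rewrite mulrC -ltr_pdivlMr//.
  by near: y; apply: cvgr_dist_lt; rewrite ?divr_gt0//; exact: cvg_id.
have var_le B n : (0 < n)%N -> (forall x, `|f x| <= B) ->
    linstat_var (mu n) n f <= L ^+ 2 * (gamma (mu n) n.-1 / gamma (mu n) n) ^+ 2.
  move=> n0 fB; rewrite -(linstat_var_id (adm n) n0).
  have bf : bounded_measurable f by split=> //; exists B.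
  have := @linstat_var_compare _ _ (adm n) n f id 0 (L ^+ 2).
  rewrite mulr0 add0r; apply => //.
  - split=> a b; first exact: (Rintegrable_gram (adm n)).
    exact: (Rintegrable_gram (adm n) _ _ (bounded_measurable_sqr mf fB)).
  - exact: gram_integrable_id.
  - exact: sqr_ge0.
  - move=> x y; rewrite add0r -exprMn -[leLHS]ger0_norm ?sqr_ge0//.
    rewrite -[leRHS]ger0_norm ?sqr_ge0// !normrX ler_sqr ?nnegrE// normrM.
    by rewrite (ger0_norm L0).
have [fy|f0|[B B0 [fB leB]]] := supnorm_cases f.
- near=> n; apply: OPE_le2; first exact: measurable_linstat_dist_ge.
  rewrite fy mulry gtr0_sg// mul1e invey.
  rewrite oppe_ge0 mule_ge0_le0 ?lee_fin ?(ltW e0)//.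
  by rewrite ge_min lexx orbT.
- near=> n; rewrite OPE_linstat_null//.
  by rewrite mule_ge0 ?expeR_ge0// lee_fin.
near=> n; have n0 : (0 < n)%N by near: n; exact: nbhs_infty_gt.
have gn : (gamma (mu n) n.-1 / gamma (mu n) n) ^+ 2 <= C by near: n.
have vn : linstat_var (mu n) n f <= L ^+ 2 * C.
  by rewrite (le_trans (var_le B n n0 leB))// ler_wpM2l// sqr_ge0.
(* For a constant [f] the first term of the minimum is [+oo], so the second one has to be reached,
   which zero variance allows. *)
have [L00|Lgt0] := leP L 0.
  have L_0 : L = 0 by apply/eqP; rewrite eq_le L00.
  rewrite L_0 expr0n mul0r in vn.
  have := @OPE_linstat_tail_sup _ _ _ _ _ _ (adm n) mf leB B0 e0 vn.
  rewrite mulr0 => /(_ (ltW (mulr_gt0 e0 B0))) /le_trans; apply.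
  rewrite fL L_0 -EFin_expe expr0n mule0 inve0 gt0_muley ?lte_fin//.
  by rewrite (min_idPr _) ?leey// fB expeR_divE.
have V0 : 0 < L ^+ 2 * C by rewrite mulr_gt0 ?exprn_gt0.
rewrite fL fB -EFin_expe -EFinM expeR_minE//; last by rewrite mulr_gt0 ?exprn_gt0//; lra.
apply: (le_trans (OPE_linstat_tail (adm n) mf leB e0 B0 V0 vn)).
by rewrite lee_fin (_ : 12 * (L ^+ 2 * C) = 4 * (3 * C) * L ^+ 2)//; ring.
Unshelve. all: end_near. Qed.

End tail_bounds.

(** * Variance o(n) for uniformly continuous functions *)

Section vanishing_variance.
Context (R : realType).

(** Near the diagonal the modulus of continuity applies; at distance at least [delta], the trivial
    bound 2 B is at most (2 B / delta) |x - y|. *)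
Lemma sqr_dist_modulus (f : R -> R) (B eta delta : R) : (forall x, `|f x| <= B) ->
  0 < delta -> 0 <= eta ->
  (forall x y, `|x - y| < delta -> `|f x - f y| <= eta) ->
  forall x y, (f x - f y) ^+ 2 <= eta ^+ 2 + (2 * B / delta) ^+ 2 * (x - y) ^+ 2.
Proof.
move=> fB d0 eta0 fd x y.
have B0 : 0 <= B := le_trans (normr_ge0 _) (fB 0).
rewrite -exprMn -[leLHS]ger0_norm ?sqr_ge0// normrX.
have [/fd fxy|xy] := ltP `|x - y| delta.
  apply: (@le_trans _ _ (eta ^+ 2)); last by rewrite lerDl sqr_ge0.
  by rewrite ler_sqr ?nnegrE.
apply: (@le_trans _ _ ((2 * B / delta * (x - y)) ^+ 2)); last by rewrite lerDr sqr_ge0.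
rewrite -[leRHS]ger0_norm ?sqr_ge0// normrX ler_sqr ?nnegrE//.
rewrite normrM (ger0_norm (divr_ge0 (mulr_ge0 _ B0) (ltW d0)))//.
apply: (@le_trans _ _ (2 * B)).
  by rewrite (le_trans (ler_normB _ _))// (le_trans (lerD (fB x) (fB y)))//; lra.
by rewrite -mulrA ler_peMr ?mulr_ge0// mulrC ler_pdivlMr// mul1r.
Qed.

Lemma linstat_var_small (mu : nat -> probability R R) (f : R -> R) (B : R) :
  (forall n, admissible (mu n)) -> measurable_fun setT f -> (forall x, `|f x| <= B) ->
  (forall eta, 0 < eta -> exists2 delta, 0 < delta &
    forall x y, `|x - y| < delta -> `|f x - f y| <= eta) ->
  (forall d, 0 < d -> \forall n \near \oo,
    (gamma (mu n) n.-1 / gamma (mu n) n) ^+ 2 <= n%:R * d) ->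
  forall c, 0 < c -> \forall n \near \oo, linstat_var (mu n) n f <= n%:R * c.
Proof.
move=> adm mf fB uf an c c0.
(* Half of [c] goes to the modulus of continuity and half to the variance of the identity. *)
have eta0 : 0 < Num.sqrt (c / 2) by rewrite sqrtr_gt0 divr_gt0.
have [delta d0 fd] := uf _ eta0.
have mod := sqr_dist_modulus fB d0 (ltW eta0) fd.
rewrite sqr_sqrtr in mod; last by rewrite divr_ge0// ltW.
set M := (2 * B / delta) ^+ 2 in mod.
have M0 : 0 <= M by exact: sqr_ge0.
(* The denominator has [M + 1] because [M] may be 0. *)
have d'0 : 0 < c / (2 * (M + 1)) by rewrite divr_gt0// mulr_gt0//; lra.
have an' := an _ d'0.
near=> n; have n0 : (0 < n)%N by near: n; exact: nbhs_infty_gt.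
have ann : (gamma (mu n) n.-1 / gamma (mu n) n) ^+ 2 <= n%:R * (c / (2 * (M + 1))).
  by near: n.
have nR : (0 : R) < n%:R by rewrite ltr0n.
have bf : bounded_measurable f by split=> //; exists B.
have gf : gram_integrable (mu n) n f.
  split=> a b; first exact: (Rintegrable_gram (adm n)).
  exact: (Rintegrable_gram (adm n) _ _ (bounded_measurable_sqr mf fB)).
have c20 : 0 <= c / 2 by rewrite divr_ge0// ltW.
have := linstat_var_compare (adm n) gf (gram_integrable_id (adm n) n) c20 M0 mod.
rewrite linstat_var_id// => /le_trans; apply.
have := ler_wpM2l M0 ann.
have : M * (n%:R * (c / (2 * (M + 1)))) <= n%:R * (c / 2).
  rewrite mulrCA ler_pM2l// mulrA ler_pdivrMr; last by rewrite mulr_gt0//; lra.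
  have -> : c / 2 * (2 * (M + 1)) = c * M + c by field.
  by rewrite mulrC; lra.
lra.
Unshelve. all: end_near. Qed.

Lemma compact_support_interval (mu : probability R R) : compact (msupport mu) ->
  exists2 M : R, 0 <= M & mu (~` `[- M, M]) = 0%E.
Proof.
move=> /compact_bounded[M [Mr MB]].
have M0 : 0 <= `|M| + 1 by rewrite addr_ge0.
exists (`|M| + 1) => //; apply: mu_compl_itv0 => x xS.
rewrite /= in_itv/= -ler_norml; apply: MB => //.
by rewrite (le_lt_trans (ler_norm _))// ltrDl.
Qed.

End vanishing_variance.

(** * The almost sure limit *)

Section almost_sure_limit.
Context (R : realType).

Lemma integral_CD_measure (mu : probability R R) n (f : R -> R) B :
  admissible mu -> (0 < n)%N -> measurable_fun setT f -> (forall x, `|f x| <= B) ->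
  (\int[CD_measure mu n]_x (f x)%:E)%E = (mean_linstat mu n f / n%:R)%:E.
Proof.
move=> adm n0 mf fB; rewrite integral_density// (mean_linstatE adm n mf fB).
have E x : f x * CD_weight mu n x =
    n%:R^-1 * \sum_(a < n) f x * (orthofun mu a x * orthofun mu a x).
  by rewrite /CD_weight /CD_kernel -mulr_sumr mulrA [RHS]mulrC.
have int a : Rintegrable mu (fun x => f x * (@orthofun R mu n a x * orthofun mu a x)).
  exact: (Rintegrable_orthofun adm _ _ mf fB).
have ints : Rintegrable mu
    (fun x => \sum_(a < n) f x * (orthofun mu a x * orthofun mu a x)).
  by apply: Rintegrable_sum => a _.
under eq_integral do rewrite E.
rewrite Rintegral_EFin; last exact: (RintegrableZl _ ints).
rewrite RintegralZl// Rintegral_sum// mulrC /mxtrace.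
by congr (_ * _)%:E; apply: eq_bigr => a _; rewrite mxE.
Qed.

Lemma nneseries_geometric_lty (u : (\bar R)^nat) (c : R) : 0 < c ->
  (forall n, 0 <= u n)%E ->
  (forall n, u n <= (2 * expR (- (n%:R * c)))%:E)%E -> (\sum_(n <oo) u n < +oo)%E.
Proof.
move=> c0 u0 uc.
pose q := expR (- c).
have q1 : `|q| < 1 by rewrite ger0_norm ?expR_ge0// -expR0 ltr_expR; lra.
have le k : (\sum_(0 <= n < k) u n <= (2 * (1 - q)^-1)%:E)%E.
  apply: (@le_trans _ _ (\sum_(0 <= n < k) (geometric 2 q n)%:E)%E).
    apply: lee_sum => n _; rewrite /= /q -expRM_natl.
    by rewrite mulrN; exact: uc.
  rewrite sumEFin lee_fin; apply: geometric_le_lim => //.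
  exact: expR_gt0.
apply: (@le_lt_trans _ _ (2 * (1 - q)^-1)%:E); last exact: ltry.
apply: lime_le; first exact: is_cvg_nneseries.
by near=> k; exact: le.
Unshelve. all: end_near. Qed.

(** The deviation probabilities are summable in [n], so the first Borel-Cantelli lemma applies; it
    needs no independence, whence the arbitrary coupling. The means converge by [weak_limit], being
    integrals against [CD_measure]. *)
Lemma linstat_as_limit (mu : nat -> probability R R) (nu : probability R R) (f : R -> R) :
  (forall n, admissible (mu n)) ->
  weak_limit (fun n => CD_measure (mu n) n) nu ->
  continuous f -> bounded_fun f ->
  forall (d : measure_display) (Omega : measurableType d)
    (P : probability Omega R) (lambda : forall n, {RV P >-> n.-tuple R}),
    (forall n (B : set (n.-tuple R)), measurable B ->
      distribution P (lambda n) B = OPE (mu n) n B) ->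
    {ae P, forall w,
      linstat f (lambda n w) / n%:R @[n --> \oo] --> \int[nu]_x f x}.
Proof.
move=> adm wl cf bf d Omega P lambda law.
have mf : measurable_fun setT f by exact: continuous_measurable_fun.
have [B B0 fB] : exists2 B, 0 < B & forall x, `|f x| <= B.
  have [M [Mr MB]] := bf.
  exists (`|M| + 1) => [|x]; first by rewrite ltr_wpDl.
  by apply: MB => //; rewrite (le_lt_trans (ler_norm _))// ltrDl.
pose m n := mean_linstat (mu n) n f.
have m_lim : m n / n%:R @[n --> \oo] --> \int[nu]_x f x.
  have intf : Rintegrable nu f.
    have int1 : Rintegrable nu (fun=> 1) by exact: finite_measure_integrable_cst.
    by have := RintegrableMl mf fB int1; under eq_fun do rewrite mulr1.
  have := wl f cf bf; rewrite Rintegral_EFin// => /fine_cvgP[_].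
  apply: cvg_trans; apply: near_eq_cvg; near=> n.
  have n0 : (0 < n)%N by near: n; exact: nbhs_infty_gt.
  by rewrite /= (integral_CD_measure (adm n) n0 mf fB).
pose F k n : set Omega :=
  [set w | k.+1%:R^-1 <= `|linstat f (lambda n w) / n%:R - m n / n%:R|].
have mE k n : measurable [set l : n.-tuple R |
    k.+1%:R^-1 <= `|linstat f l / n%:R - m n / n%:R|].
  (* For n = 0 the division by zero gives 0, and the event is everything or nothing. *)
  case: n => [|n]; last by rewrite scaled_eventE//; exact: measurable_linstat_dist_ge.
  under eq_set do rewrite -mulrBl invr0 mulr0 normr0.
  by case: (_ <= 0 :> R); [rewrite (_ : [set _ | _] = setT)|rewrite (_ : [set _ | _] = set0)];
     rewrite // ; apply/seteqP; split.
have mF k n : measurable (F k n).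
  by have := measurable_funPT (lambda n) measurableT _ (mE k n); rewrite setTI.
have PF k n : P (F k n) = OPE (mu n) n [set l : n.-tuple R |
    k.+1%:R^-1 <= `|linstat f l / n%:R - m n / n%:R|].
  by rewrite -law.
have F0 k : P (lim_sup_set (F k)) = 0%E.
  apply: lim_sup_set_cvg0 => //.
  pose e : R := k.+1%:R^-1.
  have e0 : 0 < e by rewrite invr_gt0.
  (* A decay rate independent of [n]: both the deviation and the variance bound scale like [n]. *)
  pose c := e * Num.min (e / (12 * B ^+ 2)) (6 * B)^-1.
  have c0 : 0 < c.
    by rewrite mulr_gt0// lt_min !divr_gt0 ?invr_gt0 ?mulr_gt0 ?exprn_gt0.
  apply: (nneseries_geometric_lty c0) => // n.
  case: n => [|n].
    by rewrite mul0r oppr0 expR0 mulr1 (le_trans (probability_le1 P (mF k 0)))// lee_fin ler1n.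
  have nR : (0 : R) < n.+1%:R by rewrite ltr0n.
  rewrite [leLHS](PF k n.+1) scaled_eventE//.
  have V0 : 0 < n.+1%:R * B ^+ 2 by rewrite mulr_gt0 ?exprn_gt0.
  have ne0 : 0 < n.+1%:R * e by rewrite mulr_gt0.
  apply: (le_trans (OPE_linstat_tail (adm n.+1) mf fB ne0 B0 V0
    (linstat_var_le (adm n.+1) n.+1 mf fB))).
  rewrite lee_fin /c mulrA (_ : n.+1%:R * e / (12 * (n.+1%:R * B ^+ 2)) = e / (12 * B ^+ 2))//.
  by field; rewrite !gt_eqF.
(* Countably many thresholds 1 / (k + 1) share one null exceptional set. *)
have aeF : {ae P, forall w, forall k, ~ lim_sup_set (F k) w}.
  apply: ae_foralln => k.
  have mL : measurable (lim_sup_set (F k)).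
    by apply: bigcap_measurable => // n _; apply: bigcup_measurable.
  exists (lim_sup_set (F k)); split=> //; first exact: F0.
  by move=> w /= /contrapT.
apply: filterS aeF => w wF.
have diff0 : linstat f (lambda n w) / n%:R - m n / n%:R @[n --> \oo] --> 0.
  apply/cvgrPdist_lt => e e0.
  have [k ke] : exists k, k.+1%:R^-1 < e.
    by have [k _ /(_ _ (leqnn k))] := near_infty_natSinv_lt (PosNum e0); exists k.
  have := wF k; rewrite /lim_sup_set /= => /existsNP[n0 /not_implyP[_ nF]].
  near=> n; rewrite sub0r normrN; apply: le_lt_trans ke.
  rewrite leNgt; apply/negP => lt; apply: nF; exists n; last exact: ltW.
  by near: n; exact: nbhs_infty_ge.
have -> : (fun n => linstat f (lambda n w) / n%:R) = (fun n =>
    linstat f (lambda n w) / n%:R - m n / n%:R + m n / n%:R :> R).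
  by apply/funext => n; rewrite subrK.
by rewrite -[X in _ --> X]add0r; exact: cvgD.
Unshelve. all: end_near. Qed.

End almost_sure_limit.

Theorem theorem4p5 (R : realType) :
  (* I, the inequality *)
  (exists A : R, 0 < A /\
    forall (mu : probability R R) (f : R -> R) (eps : R) (n : nat),
      admissible mu -> measurable_fun setT f -> bounded_fun f ->
      0 < eps -> (0 < n)%N ->
      (OPE mu n [set l | (eps <= `|linstat f l / n%:R
                                   - mean_linstat mu n f / n%:R|)%R]
       <= 2%:E * expeR (- ((n%:R * eps)%:E *
            mine (eps%:E / ((8 * A)%:E * supnorm f ^+ 2))
                 (6%:E * supnorm f)^-1)))%E)
  /\
  (* I, the almost sure limit *)
  (forall (mu : nat -> probability R R) (nu : probability R R) (f : R -> R),
    (forall n, admissible (mu n)) ->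
    weak_limit (fun n => CD_measure (mu n) n) nu ->
    continuous f -> bounded_fun f ->
    forall (d : measure_display) (Omega : measurableType d)
      (P : probability Omega R) (lambda : forall n, {RV P >-> n.-tuple R}),
      (forall n (B : set (n.-tuple R)), measurable B ->
        distribution P (lambda n) B = OPE (mu n) n B) ->
      {ae P, forall w,
        linstat f (lambda n w) / n%:R @[n --> \oo] --> \int[nu]_x f x})
  /\
  (* II, fixed measure *)
  (forall (mu : probability R R) (f : R -> R) (eps : R),
    admissible mu -> compact (msupport mu) -> continuous f -> 0 < eps ->
    \forall n \near \oo,
      (OPE mu n [set l | (eps <= `|linstat f l / n%:R
                                   - mean_linstat mu n f / n%:R|)%R]
       <= 2%:E * expeR (- ((n%:R * eps)%:E / (6%:E * supnorm f))))%E)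
  /\
  (* II, varying measures *)
  (forall (mu : nat -> probability R R) (f : R -> R) (eps : R),
    (forall n, admissible (mu n)) ->
    n%:R^-1 * (gamma (mu n) n.-1 / gamma (mu n) n) ^+ 2 @[n --> \oo] --> 0 ->
    unif_continuous f -> bounded_fun f -> 0 < eps ->
    \forall n \near \oo,
      (OPE (mu n) n [set l | (eps <= `|linstat f l / n%:R
                                       - mean_linstat (mu n) n f / n%:R|)%R]
       <= 2%:E * expeR (- ((n%:R * eps)%:E / (6%:E * supnorm f))))%E)
  /\
  (* III, fixed measure *)
  (forall mu : probability R R, admissible mu -> compact (msupport mu) ->
    exists A : R, 0 < A /\
    forall (f : R -> R) (eps : R), lipschitz f -> 0 < eps ->
    \forall n \near \oo,
      (OPE mu n [set l | (eps <= `|linstat f l - mean_linstat mu n f|)%R]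
       <= 2%:E * expeR (- (eps%:E *
            mine (eps%:E / ((4 * A)%:E * lipnorm f ^+ 2))
                 (6%:E * supnorm f)^-1)))%E)
  /\
  (* III, varying measures *)
  (forall mu : nat -> probability R R, (forall n, admissible (mu n)) ->
    (fun n => (gamma (mu n) n.-1 / gamma (mu n) n) ^+ 2) =O_\oo (fun=> 1 : R) ->
    exists A : R, 0 < A /\
    forall (f : R -> R) (eps : R), lipschitz f -> 0 < eps ->
    \forall n \near \oo,
      (OPE (mu n) n [set l | (eps <= `|linstat f l
                                       - mean_linstat (mu n) n f|)%R]
       <= 2%:E * expeR (- (eps%:E *
            mine (eps%:E / ((4 * A)%:E * lipnorm f ^+ 2))
                 (6%:E * supnorm f)^-1)))%E).
Proof.
split; first exact: bounded_concentration.
split; first exact: linstat_as_limit.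
split.
  move=> mu f eps adm cs cf e0.
  have [M M0 muM] := compact_support_interval cs.
  have mf : measurable_fun setT f by exact: continuous_measurable_fun.
  apply: (@small_variance_concentration _ (fun=> mu)) => // -[B fB] c c0.
  have mfc : measurable_fun setT (f \o clamp M).
    by apply: measurableT_comp => //; exact: measurable_clamp.
  (* Off the support [f] may fail to be uniformly continuous; clamping repairs this without changing
     the variance. *)
  suff : \forall n \near \oo, linstat_var mu n (f \o clamp M) <= n%:R * c.
    by apply: filterS => n; rewrite (linstat_var_clamp muM _ mf).
  apply: (@linstat_var_small _ (fun=> mu) _ B) => //.
  - by move=> x; exact: fB.
  - move=> eta eta0; have [delta d0 H] := heine_clamp M0 cf eta0.
    by exists delta => // x y /H /ltW.
  - move=> d d0; near=> n.
    have n0 : (0 < n)%N by near: n; exact: nbhs_infty_gt.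
    apply: (le_trans (gamma_ratio_le adm M0 muM n0)).
    rewrite -ler_pdivrMr//.
    by near: n; exact: nbhs_infty_ger.
split.
  move=> mu f eps adm a0 uf [N [Nr NB]] e0.
  have mf : measurable_fun setT f.
    apply: continuous_measurable_fun => x; apply/cvgrPdist_lt => e e_gt0.
    have [delta d0 H] := (unif_continuousP f).1 uf e e_gt0.
    near=> y; apply: (H (x, y)); rewrite /=.
    by near: y; exact: (nbhsx_ballx x _ d0).
  apply: small_variance_concentration => // -[B fB] c c0.
  apply: (@linstat_var_small _ mu f B) => //.
  - move=> eta eta0; have [delta d0 H] := (unif_continuousP f).1 uf eta eta0.
    by exists delta => // x y xy; apply/ltW; exact: (H (x, y)).
  - move=> d d0; have near_a := (cvgrPdist_lt _ _).1 a0 d d0.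
    apply: filterS2 (nbhs_infty_gt 0) (near_a eventually_filter) => n n0.
    rewrite sub0r normrN => /(le_lt_trans (ler_norm _)).
    by rewrite ltr_pdivrMl ?ltr0n// => /ltW.
split.
  move=> mu adm cs; have [M M0 muM] := compact_support_interval cs.
  (* The added 1 makes the constant positive without a case distinction on [M]. *)
  apply: (@lipschitz_concentration _ (fun=> mu) (M ^+ 2 + 1)) => //.
    by rewrite ltr_wpDl ?sqr_ge0.
  near=> n; have n0 : (0 < n)%N by near: n; exact: nbhs_infty_gt.
  by rewrite (le_trans (gamma_ratio_le adm M0 muM n0))// lerDl.
move=> mu adm /eqO_exP[k k0 kP].
apply: (lipschitz_concentration adm k0).
apply: filterS kP => n; rewrite normr1 mulr1 => /(le_trans _); apply.
exact: ler_norm.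
Unshelve. all: end_near. Qed.
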